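(* Let $G$ be a symmetry group of the Lagrangian action functional of the planar $3$-body problem. Then $G$ is either bound to collisions, or fully uncoercive, or homographic, or, up to a change of rotating frame, it is conjugated to one of the following ten symmetry groups: Trivial, Line, $2$-$1$-choreography, Isosceles, Hill, $3$-choreography, Lagrange, $C_6$, $D_6$, $D_{12}$ (explicitly listed in the context).
   Context: **Setting.** $E=\mathbb{R}^2\cong\mathbb{C}$, $J$ is the complex unit, $m_1,m_2,m_3>0$ are masses, $\alpha>0$. $\mathcal{X}=\{x=(x_1,x_2,x_3)\in E^3:\sum_i m_ix_i=0\}$; $\Delta=\{x\in\mathcal{X}: x_i=x_j\text{ for some }i\ne j\}$; $U(x)=\sum_{i<j}\frac{m_im_j}{|x_i-x_j|^\alpha}$; $\mathbb{T}=\mathbb{R}/2\pi\mathbb{Z}$, regarded as a circle on which $O(2)$ acts by isometries; $\Lambda=H^1(\mathbb{T},\mathcal{X})$. For $\omega\in\mathbb{R}$ the Lagrangian action functional is $\mathcal{A}_\omega(x)=\int_{\mathbb{T}}\big(\sum_i\frac12 m_i|\dot x_i-J\omega x_i|^2+U(x)\big)dt\in\mathbb{R}\cup\{\infty\}$. **Symmetry groups.** A symmetry group is a finite group $G$ with homomorphisms $\tau,\rho:G\to O(2)$ and $\sigma:G\to\Sigma_3$ such that $\sigma(g)(i)=j$ implies $m_i=m_j$. $G$ acts on $\mathbb{T}$ via $\tau$, on $E$ via $\rho$, on $\mathcal{X}$ by $(gx)_i=\rho(g)x_{\sigma(g^{-1})(i)}$, and on $\Lambda$ by $(g\cdot x)(t)=g\,x(g^{-1}t)$.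 $\mathcal{X}^G$ and $\Lambda^G$ are the sets of fixed points; elements of $\Lambda^G$ are the equivariant loops. Standing assumptions: (i) $\ker\tau\cap\ker\rho\cap\ker\sigma=1$; (ii) there is no proper linear subspace $E'\subsetneq E$ with $x_i(t)\in E'$ for all $i$, all $x\in\Lambda^G$, all $t$; (iii) there is no integer $k\ne\pm1$ such that every $x\in\Lambda^G$ has the form $x(t)=y(kt)$ with $y\in\Lambda$ (equivalently $G$ has no redundant element, where $g\neq 1$ is redundant if $\tau(g)\ne1$, $\det\tau(g)=1$, $\sigma(g)=1$, $\rho(g)=1$). **Definitions.** $G$ is *of type R* if $\det\circ\rho=\det\circ\tau$. $G$ is *coercive* if $\mathcal{A}_0$ restricted to $\Lambda^G$ tends to $\infty$ as the $H^1$-norm tends to $\infty$. $G$ is *fully uncoercive* if it is neither of type R nor coercive. $G$ is *bound to collisions* if every $x\in\Lambda^G$ satisfies $x(t)\in\Delta$ for some $t\in\mathbb{T}$. $G$ is *homographic* if every equivariant loop is constant up to similarity, i.e. $x(t)=z(t)\xi$ with $z$ complex-valued and $\xi$ a fixed configuration. **Change of rotating frame.** If $G$ is of type R, write $\tau(g)t=\det(\tau(g))\,t+\delta(g)\pmod{2\pi}$. For an integer $\omega$ the substitution $x_i(t)=e^{J\omega t}q_i(t)$ transforms the $G$-equivariant loops $x$ into the loops $q$ equivariant for the action with the same $\tau,\sigma$ and with $\rho$ replaced by $g\mapsto e^{-J\omega\delta(g)}\rho(g)$. After this substitution the subgroup $H$ consisting of $1$ and of the redundant elements (if any) is modded out: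 $G$ is replaced by $G/H$ and the time circle $\mathbb{T}$ by $\mathbb{T}/H$, rescaled to length $2\pi$. For groups not of type R no change is made. **Conjugation.** Two symmetry groups are conjugated if their images under $(\tau,\rho,\sigma)$ are conjugate subgroups of $O(2)\times O(2)\times\Sigma_3$. **The list.** Each group is given by generators $(\tau,\rho,\sigma)$; $s$ denotes the time reflection $t\mapsto -t$, $R_\theta$ the time rotation $t\mapsto t+\theta$, $l$ the reflection of $E$ along a line, $-1$ the antipodal map of $E$, $()$ the identical permutation. Trivial: the group of order $1$. Line (order 2): $(s,l,())$. $2$-$1$-choreography (order 2): $(R_\pi,1,(1,2))$. Isosceles (order 2): $(s,l,(1,2))$. Hill (order 4): $(R_\pi,1,(1,2))$ and $(s,l,())$. $3$-choreography (order 3): $(R_{2\pi/3},1,(1,2,3))$. Lagrange (order 6): $(R_{2\pi/3},1,(1,2,3))$ and $(s,l,(1,2))$. $C_6$ (order 6): $(R_{\pi/3},l,(1,2,3))$. $D_{12}$ (order 12): $(R_{\pi/3},l,(1,2,3))$ and $(s,-1,(1,2))$. $D_6$ (order 6): the subgroup of $D_{12}$ generated by $(s,-1,(1,2))$ and the order-3 subgroup of $C_6$. *)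

(* Defs.v *)
From HB Require Import structures.
From mathcomp Require Import all_boot all_order all_fingroup all_algebra.
From mathcomp Require Import all_classical all_reals all_analysis.

Set Implicit Arguments.
Unset Strict Implicit.
Unset Printing Implicit Defensive.

Import Order.TTheory GRing.Theory Num.Theory.
Import numFieldNormedType.Exports.

Local Open Scope classical_set_scope.
Local Open Scope ring_scope.

Section Plane.
Variable R : realType.

Definition Jmx : 'M[R]_2 :=
  \matrix_(i < 2, j < 2) (if i == j then 0 else if i == 0 then -1 else 1).

(* The matrix of multiplication by the complex number a + b J. *)
Definition cmul (a b : R) : 'M[R]_2 := a%:M + b *: Jmx.

Definition rotmx (theta : R) : 'M[R]_2 := cmul (cos theta) (sin theta).

(* The reflection in the first coordinate axis; it maps circ t to circ (- t), so
   as an isometry of T it is the time reflection. *)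
Definition reflmx : 'M[R]_2 := diag_mx (\row_(j < 2) (-1) ^+ j).

Definition orthogonal2 (A : 'M[R]_2) : Prop := A *m A^T = 1%:M.

(* The library norm on matrices is the sup norm; this is the Euclidean one. *)
Definition enorm (u : 'cV[R]_2) : R := Num.sqrt (\sum_(a < 2) u a 0 ^+ 2).

(* Loops on T = R / 2 pi Z are 2 pi-periodic functions on R. A matrix A in O(2)
   acts on T through the identification of the class of t with circ t;
   [time_act A t] is some representative of the image of the class of t. *)
Definition circ (t : R) : 'cV[R]_2 :=
  \col_(a < 2) (if a == 0 then cos t else sin t).

Definition angle (u : 'cV[R]_2) : R := xget 0 [set t : R | circ t = u].

Definition time_act (A : 'M[R]_2) (t : R) : R := angle (A *m circ t).

End Plane.

Section Loops.
Variables (R : realType) (m : 'I_3 -> R).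

Definition period : set R := `[0, 2 * pi].

Definition conf := 'I_3 -> 'cV[R]_2.

Definition centred (x : conf) : Prop := \sum_(i < 3) m i *: x i = 0.

Definition collision (x : conf) : bool :=
  [exists i, exists j, (i != j) && (x i == x j)].

Definition Delta : set conf := [set x | centred x /\ collision x].

Definition potential (alpha : R) (x : conf) : \bar R :=
  if collision x then +oo%E else
  (\sum_(i < 3) \sum_(j < 3 | (i < j)%N)
     m i * m j / (enorm (x i - x j) `^ alpha))%:E.

(* x is the continuous representative of an element of H^1(T, X), and v is a
   representative on [0, 2 pi] of its derivative in L^2. *)
Record H1_loop (x v : R -> conf) : Prop := {
  H1_periodic : forall t, x (t + 2 * pi) = x t;
  H1_centred : forall t, centred (x t);
  H1_measurable : forall (i : 'I_3) (a : 'I_2),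
    measurable_fun period (fun t : R => v t i a 0);
  H1_square_integrable : forall (i : 'I_3) (a : 'I_2),
    (\int[lebesgue_measure]_(t in period) ((v t i a 0) ^+ 2)%:E < +oo)%E;
  H1_primitive : forall (i : 'I_3) (a : 'I_2) (t : R), 0 <= t <= 2 * pi ->
    x t i a 0 = x 0 i a 0 + \int[lebesgue_measure]_(s in `[0, t]) v s i a 0
}.

Definition Lambda : set (R -> conf) := [set x | exists v, H1_loop x v].

Definition H1_norm (x v : R -> conf) : R :=
  Num.sqrt (\int[lebesgue_measure]_(t in period)
    \sum_(i < 3) (enorm (x t i) ^+ 2 + enorm (v t i) ^+ 2)).

Definition action_functional (alpha omega : R) (x v : R -> conf) : \bar R :=
  (\int[lebesgue_measure]_(t in period)
    ((\sum_(i < 3) 2^-1 * m i *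
        enorm (v t i - Jmx R *m (omega *: x t i)) ^+ 2)%R%:E
     + potential alpha (x t)))%E.

End Loops.

Record sym_data (R : realType) (gT : finGroupType) := SymData {
  tau : gT -> 'M[R]_2;
  rho : gT -> 'M[R]_2;
  sigma : gT -> 'S_3
}.

Section SymmetryGroups.
Variables (R : realType) (m : 'I_3 -> R) (gT : finGroupType).
Implicit Types (G : sym_data R gT) (g h : gT).

(* [sigma] is a left action on the bodies. The product of 'S_3 composes
   permutations from left to right, hence the pointwise form of sigma_hom. *)
Record symmetry_group G : Prop := {
  tau_orthogonal : forall g, orthogonal2 (tau G g);
  rho_orthogonal : forall g, orthogonal2 (rho G g);
  tau_hom : forall g h, tau G (g * h)%g = tau G g *m tau G h;
  rho_hom : forall g h, rho G (g * h)%g = rho G g *m rho G h;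
  sigma_hom : forall g h i, sigma G (g * h)%g i = sigma G g (sigma G h i);
  sigma_mass : forall g i j, sigma G g i = j -> m i = m j
}.

Definition conf_act G g (x : conf R) : conf R :=
  fun i => rho G g *m x (sigma G (g^-1)%g i).

Definition loop_act G g (x : R -> conf R) : R -> conf R :=
  fun t => conf_act G g (x (time_act (tau G (g^-1)%g) t)).

Definition equivariant_loops G : set (R -> conf R) :=
  [set x | Lambda m x /\ forall g, loop_act G g x = x].

Definition trivial_kernel G : Prop :=
  forall g, tau G g = 1%:M -> rho G g = 1%:M -> sigma G g = 1%g -> g = 1%g.

Definition spans_plane G : Prop :=
  ~ exists E' : {vspace 'cV[R]_2}, E' != fullv /\
      forall x, equivariant_loops G x -> forall t i, x t i \in E'.

Definition no_common_covering G : Prop :=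
  ~ exists k : int, k != 1 /\ k != -1 /\
      forall x, equivariant_loops G x ->
        exists y, Lambda m y /\ forall t, x t = y (k%:~R * t).

Definition type_R G : Prop := forall g, \det (rho G g) = \det (tau G g).

Definition coercive (alpha : R) G : Prop :=
  forall M : R, exists K : R, forall x v,
    H1_loop m x v -> equivariant_loops G x ->
    K <= H1_norm x v -> (M%:E <= action_functional m alpha 0 x v)%E.

Definition fully_uncoercive (alpha : R) G : Prop :=
  ~ type_R G /\ ~ coercive alpha G.

Definition bound_to_collisions G : Prop :=
  forall x, equivariant_loops G x -> exists t, Delta m (x t).

Definition homographic G : Prop :=
  forall x, equivariant_loops G x ->
    exists (a b : R -> R) (xi : conf R), centred m xi /\
      forall t i, x t i = cmul (a t) (b t) *m xi i.

Definition redundant G g : bool :=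
  [&& g != 1%g, tau G g != 1%:M, \det (tau G g) == 1,
      sigma G g == 1%g & rho G g == 1%:M].

(* tau G g acts on T by t |-> \det (tau G g) * t + delta G g. *)
Definition delta G g : R := time_act (tau G g) 0.

Definition rotate (omega : int) G : sym_data R gT :=
  SymData (tau G) (fun g => rotmx (- (omega%:~R * delta G g)) *m rho G g)
          (sigma G).

End SymmetryGroups.

(* G' is (up to isomorphism) the group G / H, with H = {1} + redundant elements.
   H acts on T by rotations, as the cyclic group generated by the rotation of
   angle 2 pi / k with k = #|H|, so t |-> k t identifies T / H, rescaled to length
   2 pi, with T; the last clause is the induced action of G / H on T / H. *)
Definition quotient_by_redundant (R : realType) (gT hT : finGroupType)
    (G : sym_data R gT) (G' : sym_data R hT) : Prop :=
  exists p : {morphism [set: gT]%SET >-> hT},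
    [/\ forall h : hT, exists g, p g = h,
        ('ker p)%g = [set g | (g == 1%g) || redundant G g]%SET,
        forall g, rho G' (p g) = rho G g,
        forall g, sigma G' (p g) = sigma G g
      & forall g (t s : R), circ s = tau G g *m circ t ->
          circ (#|('ker p)%g|%:R * s) =
          tau G' (p g) *m circ (#|('ker p)%g|%:R * t)].

Section Models.
Variable R : realType.

(* O(2) x O(2) x Sigma_3, with permutations composed from right to left. *)
Definition triple := ('M[R]_2 * 'M[R]_2 * 'S_3)%type.

Definition in_O2O2S3 (c : triple) : Prop :=
  orthogonal2 c.1.1 /\ orthogonal2 c.1.2.
Definition tone : triple := (1%:M, 1%:M, 1%g).
Definition tmul (c d : triple) : triple :=
  (c.1.1 *m d.1.1, c.1.2 *m d.1.2, (d.2 * c.2)%g).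
Definition tinv (c : triple) : triple :=
  (invmx c.1.1, invmx c.1.2, (c.2^-1)%g).

Inductive generated_by (S : seq triple) : triple -> Prop :=
| gen_one : generated_by S tone
| gen_in c : c \in S -> generated_by S c
| gen_mul c d : generated_by S c -> generated_by S d -> generated_by S (tmul c d)
| gen_inv c : generated_by S c -> generated_by S (tinv c).

Definition image_group (gT : finGroupType) (G : sym_data R gT) : set triple :=
  range (fun g => (tau G g, rho G g, sigma G g) : triple).

Definition conjugated (A B : set triple) : Prop :=
  exists c, in_O2O2S3 c /\ A = (fun d => tmul (tmul c d) (tinv c)) @` B.

(* The bodies 1, 2, 3 are the elements 0, 1, 2 of 'I_3. *)
Definition transp12 : 'S_3 := tperm 0 1.
Definition cycle123 : 'S_3 := perm (addIr (1 : 'I_3)).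

Inductive model := Trivial | Line | Choreography21 | Isosceles | Hill
  | Choreography3 | Lagrange | C6 | D6 | D12.

Definition generators (L : model) : seq triple :=
  let s := reflmx R in
  let l := reflmx R in
  let c6 : triple := (rotmx (pi / 3), l, cycle123) in
  match L with
  | Trivial => [::]
  | Line => [:: (s, l, 1%g)]
  | Choreography21 => [:: (rotmx pi, 1%:M, transp12)]
  | Isosceles => [:: (s, l, transp12)]
  | Hill => [:: (rotmx pi, 1%:M, transp12); (s, l, 1%g)]
  | Choreography3 => [:: (rotmx (2 * pi / 3), 1%:M, cycle123)]
  | Lagrange => [:: (rotmx (2 * pi / 3), 1%:M, cycle123); (s, l, transp12)]
  | C6 => [:: c6]
  | D6 => [:: (s, - 1%:M, transp12); tmul c6 c6]
  | D12 => [:: c6; (s, - 1%:M, transp12)]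
  end.

Definition model_group (L : model) : set triple := generated_by (generators L).

(* For a group of type R the frame of angular velocity 0 is among the integral
   ones; for other groups no change of frame is made. *)
Definition conjugated_up_to_frame (gT : finGroupType) (G : sym_data R gT)
    (L : model) : Prop :=
  (~ type_R G /\ conjugated (image_group G) (model_group L)) \/
  (type_R G /\
   exists (omega : int) (hT : finGroupType) (G' : sym_data R hT),
     quotient_by_redundant (rotate omega G) G' /\
     conjugated (image_group G') (model_group L)).

End Models.

(* Main.v *)
Require Import Defs.
From mathcomp Require Import all_boot all_order all_fingroup all_algebra all_solvable.
From mathcomp Require Import all_classical all_reals all_analysis.
From mathcomp Require Import measurable_realfun ring lra zify.
Import Order.TTheory GRing.Theory Num.Theory.
Import numFieldNormedType.Exports.
Set Implicit Arguments.
Unset Strict Implicit.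
Unset Printing Implicit Defensive.
Local Open Scope classical_set_scope.
Local Open Scope ring_scope.

(** Suppose that [G] is neither bound to collisions nor homographic, so that there
    is an equivariant loop [x0] without collisions.

    An element [g] of the core, the kernel of [tau], gives at every time the
    relation [x (sigma g i) = rho g *m x i]. If [rho g] is a rotation and [g] is not
    [1], this relation either contradicts [x0] or determines the triangle of the
    bodies up to similarity, so that [G] is homographic ([core_rotation]). Hence
    the core contains no rotations other than [1], and in type R it is trivial.

    In type R, [tau] is then injective and the elements acting by time rotations
    form a cyclic group with a generator [r] of time angle [2 * pi / n]
    ([rotation_generator]). The angle of the rotation [rho r] is an integral
    multiple of [2 * pi / n], and a frame of integral angular velocity removes it.
    The only invariants left are the order [1], [2] or [3] of [sigma r] and, if
    there is a time reflection, its permutation of the bodies: after the quotient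
    by the redundant elements these data are those of seven models
    ([type_R_model]).

    Outside type R, it suffices to treat the case that [G] is coercive. Then [G]
    fixes no centred configuration [xi] other than the origin: the action of
    [x0 + l xi] stays bounded while its norm tends to infinity
    ([fixed_conf_not_coercive]). A reflection in the core would yield a fixed
    configuration with two antipodal bodies, for otherwise the two bodies that it
    exchanges would cross ([core_reflection_fixed_dipole]). So [tau] is again
    injective. A time reflection fixes two times, and if [rho] maps it to a
    rotation, then the absence of collisions at these times leaves two
    possibilities: it acts trivially on configurations, or it exchanges two bodies
    by the antipodal map ([time_reflection_cases]). If [r] does not permute the
    bodies cyclically, all this leaves a fixed configuration with two antipodal
    bodies. If it does, the absence of redundant elements bounds its order, by [3]
    if [rho r] is a rotation and by [6] if it is a reflection; the corresponding
    groups are D6 in the first case and C6 and D12 in the second one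
    ([rotation_generator_case], [reflection_generator_case]). *)

(** * Isometries of the plane and of the circle *)

Section PlaneFacts.
Variable R : realType.
Implicit Types (a b c d s t : R) (A B : 'M[R]_2) (u v : 'cV[R]_2).

Lemma ord2P (i : 'I_2) : i = 0 \/ i = 1.
Proof. by case: i => [[|[|//]] hi]; [left|right]; apply: val_inj. Qed.

Lemma mx2_ext A B : A 0 0 = B 0 0 -> A 0 1 = B 0 1 -> A 1 0 = B 1 0 ->
  A 1 1 = B 1 1 -> A = B.
Proof.
move=> e00 e01 e10 e11; apply/matrixP => i j.
by have [->|->] := ord2P i; have [->|->] := ord2P j.
Qed.

Lemma cV2_ext u v : u 0 0 = v 0 0 -> u 1 0 = v 1 0 -> u = v.
Proof.
by move=> e0 e1; apply/colP => i; have [->|->] := ord2P i.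
Qed.

Lemma sum2E (V : nmodType) (F : 'I_2 -> V) : \sum_i F i = F 0 + F 1.
Proof. by rewrite big_ord_recl big_ord1; congr (_ + F _); exact: val_inj. Qed.

Lemma mul2E n p (A : 'M[R]_(n, 2)) (B : 'M[R]_(2, p)) i j :
  (A *m B) i j = A i 0 * B 0 j + A i 1 * B 1 j.
Proof. by rewrite mxE sum2E. Qed.

Lemma cmulE a b : (cmul a b 0 0 = a) * (cmul a b 0 1 = - b) *
  (cmul a b 1 0 = b) * (cmul a b 1 1 = a).
Proof.
by rewrite !mxE !eqxx /= !mulr1n !mulr0n ?mulr0 ?mulrN1 ?mulr1 ?addr0 ?add0r.
Qed.

Lemma reflmxE : (reflmx R 0 0 = 1) * (reflmx R 0 1 = 0) *
  (reflmx R 1 0 = 0) * (reflmx R 1 1 = -1).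
Proof. by rewrite !mxE /= expr0 expr1. Qed.

Lemma one2E : ((1%:M : 'M[R]_2) 0 0 = 1) * ((1%:M : 'M[R]_2) 0 1 = 0) *
  ((1%:M : 'M[R]_2) 1 0 = 0) * ((1%:M : 'M[R]_2) 1 1 = 1).
Proof. by rewrite !mxE. Qed.

Lemma circE t : (circ t 0 0 = cos t) * (circ t 1 0 = sin t).
Proof. by rewrite !mxE. Qed.

Definition mx2E := (mul2E, cmulE, reflmxE, one2E, circE).

Lemma det2E A : \det A = A 0 0 * A 1 1 - A 0 1 * A 1 0.
Proof.
rewrite (expand_det_row A 0) sum2E /cofactor !det_mx11 !mxE /= expr0 expr1.
rewrite mul1r mulN1r mulrN; congr (_ * A _ _ - _ * A _ _); exact: val_inj.
Qed.

Lemma det_cmul a b : \det (cmul a b) = a ^+ 2 + b ^+ 2.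
Proof. by rewrite det2E !mx2E; ring. Qed.

Lemma det_rotmx a : \det (rotmx a) = 1.
Proof. by rewrite det_cmul cos2Dsin2. Qed.

Lemma det_reflmx : \det (reflmx R) = -1.
Proof. by rewrite det2E !mx2E; ring. Qed.

Lemma cmulM a b c d :
  cmul a b *m cmul c d = cmul (a * c - b * d) (a * d + b * c).
Proof. by apply: mx2_ext; rewrite !mx2E; ring. Qed.

Lemma cmulC a b c d : cmul a b *m cmul c d = cmul c d *m cmul a b.
Proof. by rewrite !cmulM; congr cmul; ring. Qed.

Lemma rotmxD a b : rotmx (a + b) = rotmx a *m rotmx b.
Proof. by rewrite cmulM /rotmx cosD sinD; congr cmul; ring. Qed.

Lemma rotmx0 : rotmx 0 = 1%:M :> 'M[R]_2.
Proof. by apply: mx2_ext; rewrite !mx2E ?cos0 ?sin0 ?oppr0. Qed.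

Lemma rotmxNK a : rotmx (- a) *m rotmx a = 1%:M.
Proof. by rewrite -rotmxD addNr rotmx0. Qed.

Lemma rotmxKN a : rotmx a *m rotmx (- a) = 1%:M.
Proof. by rewrite -rotmxD addrN rotmx0. Qed.

Lemma rotmxX a n : rotmx a ^+ n = rotmx (a * n%:R).
Proof.
elim: n => [|n IH]; first by rewrite mulr0 rotmx0.
by rewrite exprS IH -mulmxE -rotmxD mulrS mulrDr mulr1.
Qed.

Lemma reflmxK : reflmx R *m reflmx R = 1%:M.
Proof. by apply: mx2_ext; rewrite !mx2E; ring. Qed.

Lemma reflmx_rotmx a : reflmx R *m rotmx a = rotmx (- a) *m reflmx R.
Proof. by apply: mx2_ext; rewrite !mx2E sinN cosN; ring. Qed.

Lemma rotmx_circ a t : rotmx a *m circ t = circ (a + t).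
Proof. by apply: cV2_ext; rewrite !mx2E (cosD, sinD); ring. Qed.

Lemma reflmx_circ t : reflmx R *m circ t = circ (- t).
Proof. by apply: cV2_ext; rewrite !mx2E (cosN, sinN); ring. Qed.

Lemma sumsq_eq0 u : u 0 0 ^+ 2 + u 1 0 ^+ 2 = 0 -> u = 0.
Proof.
move=> h; have h0 := sqr_ge0 (u 0 0); have h1 := sqr_ge0 (u 1 0).
by apply: cV2_ext; rewrite !mxE; apply/eqP; rewrite -sqrf_eq0; apply/eqP; lra.
Qed.

Lemma circ_unit t : circ t 0 0 ^+ 2 + circ t 1 0 ^+ 2 = 1.
Proof. by rewrite !mx2E cos2Dsin2. Qed.

(** The polar angle is the arc cosine of the abscissa, or its opposite modulo
    [2 * pi] when the ordinate is negative. The interval is closed on the right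
    and open on the left so that the identity gets the angle [2 * pi], which
    makes the least angle of a finite group of rotations that of a generator. *)
Lemma unit_circ u : u 0 0 ^+ 2 + u 1 0 ^+ 2 = 1 ->
  exists2 t, 0 < t <= 2 * pi & circ t = u.
Proof.
move=> u1.
have /andP[ge1 le1] : -1 <= u 0 0 <= 1.
  rewrite -ler_norml -(@ler_pXn2r _ 2) ?nnegrE// expr1n -normrX ger0_norm.
    by rewrite -u1 lerDl sqr_ge0.
  exact: sqr_ge0.
have a_le := @acos_lepi _ (u 0 0); have a_ge := @acos_ge0 _ (u 0 0).
have ac : cos (acos (u 0 0)) = u 0 0 by rewrite acosK// in_itv /= ge1.
have as_ : sin (acos (u 0 0)) = `|u 1 0|.
  by rewrite sin_acos ?ge1// -u1 [_ - _]addrAC addrN add0r sqrtr_sqr.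
rewrite ge1 le1 in a_le a_ge; move: (a_le isT) (a_ge isT) => {}a_le {}a_ge.
have pi0 := pi_gt0 R.
have [u10|u10] := ltP (u 1 0) 0.
  exists (2 * pi - acos (u 0 0)); first by lra.
  have -> : 2 * pi - acos (u 0 0) = - acos (u 0 0) + pi *+ 2 by ring.
  apply: cV2_ext; rewrite circE (cosD2pi, sinD2pi) (cosN, sinN) ?ac ?as_//.
  by rewrite ltr0_norm// opprK.
have [a0|a0] := eqVneq (acos (u 0 0)) 0.
  exists (2 * pi); first by lra.
  have -> : 2 * pi = 0 + pi *+ 2 by move=> T; ring.
  rewrite -a0; apply: cV2_ext; rewrite circE (cosD2pi, sinD2pi) ?ac ?as_//.
  by rewrite ger0_norm.
exists (acos (u 0 0)); first by rewrite lt_def a0 a_ge /=; lra.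
by apply: cV2_ext; rewrite circE ?ac ?as_// ger0_norm.
Qed.

Lemma circK u : u 0 0 ^+ 2 + u 1 0 ^+ 2 = 1 -> circ (angle u) = u.
Proof.
move=> /unit_circ[t _ tu]; apply: (@xgetPex _ 0 [set s : R | circ s = u]).
by exists t.
Qed.

Lemma circ_period t (k : int) : circ (t + k%:~R * (2 * pi)) = circ t.
Proof.
have cn n s : circ (s + n%:R * (2 * pi)) = circ s :> 'cV[R]_2.
  apply: cV2_ext; rewrite !circE.
    by rewrite -[RHS](periodicn (@cosD2pi R) n); congr cos; ring.
  by rewrite -[RHS](periodicn (@sinD2pi R) n); congr sin; ring.
case: k => n; first exact: cn.
by rewrite -[LHS](cn n.+1); congr circ; rewrite NegzE mulrNz; ring.
Qed.

Lemma cos_eq1 t : 0 <= t < 2 * pi -> cos t = 1 -> t = 0.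
Proof.
move=> /andP[t0 t2] ct; have p0 := pi_gt0 R.
have in0 : (0 : R) \in `[0, pi] by rewrite in_itv /= lexx pi_ge0.
have [tp|tp] := leP t pi.
  by apply: cos_inj; rewrite ?cos0// in_itv /= t0.
suff: 2 * pi - t = 0 by lra.
apply: cos_inj; rewrite ?cos0// ?in_itv /=; first by lra.
have -> : 2 * pi - t = - t + pi *+ 2 by ring.
by rewrite cosD2pi cosN.
Qed.

Lemma circ_eq s t : circ s = circ t -> exists k : int, s = t + k%:~R * (2 * pi).
Proof.
move=> st; have p0 : 0 < 2 * pi :> R by rewrite mulr_gt0// pi_gt0.
pose k := Num.floor ((s - t) / (2 * pi)); exists k.
have /andP[k1 k2] := floor_itv ((s - t) / (2 * pi)).
rewrite -/k in k1 k2; rewrite intrD in k2.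
suff : s - t - k%:~R * (2 * pi) = 0 by lra.
apply: cos_eq1; last first.
  have -> : s - t - k%:~R * (2 * pi) = s - (t + k%:~R * (2 * pi)) by ring.
  have := circ_period t k; rewrite -st => /colP e.
  move: (e 0) (e 1); rewrite !circE cosB => -> ->.
  by rewrite -!expr2 cos2Dsin2.
rewrite ler_pdivlMr// in k1; rewrite ltr_pdivrMr// mulrDl mul1r in k2; lra.
Qed.

Lemma rotmx_circ0 a : rotmx a *m circ 0 = circ a.
Proof. by rewrite rotmx_circ addr0. Qed.

Lemma rotmx_eq a b : circ a = circ b -> rotmx a = rotmx b.
Proof.
by move=> /colP e; move: (e 0) (e 1); rewrite !circE /rotmx => -> ->.
Qed.

Lemma rotmx_inj a b : rotmx a = rotmx b -> circ a = circ b.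
Proof. by move=> e; rewrite -(rotmx_circ0 a) e rotmx_circ0. Qed.

Lemma tr_rotmx a : (rotmx a)^T = rotmx (- a).
Proof.
by apply: mx2_ext; rewrite mxE !cmulE ?cosN ?sinN ?opprK.
Qed.

Lemma orthogonal_rotmx a : orthogonal2 (rotmx a).
Proof. by rewrite /orthogonal2 tr_rotmx rotmxKN. Qed.

Lemma orthogonal_reflmx : orthogonal2 (reflmx R).
Proof. by rewrite /orthogonal2 tr_diag_mx reflmxK. Qed.

Lemma orthogonalM A B : orthogonal2 A -> orthogonal2 B -> orthogonal2 (A *m B).
Proof.
by rewrite /orthogonal2 trmx_mul mulmxA -(mulmxA A) => oA ->; rewrite mulmx1.
Qed.

Lemma det_orthogonal A : orthogonal2 A -> \det A = 1 \/ \det A = -1.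
Proof.
move=> /(congr1 determinant); rewrite det_mulmx det_tr det1 -expr2 => /eqP.
by rewrite sqrf_eq1 => /orP[]/eqP; auto.
Qed.

Lemma orthogonal_rows A : orthogonal2 A ->
  [/\ A 0 0 ^+ 2 + A 0 1 ^+ 2 = 1, A 1 0 ^+ 2 + A 1 1 ^+ 2 = 1 &
      A 0 0 * A 1 0 + A 0 1 * A 1 1 = 0].
Proof.
rewrite /orthogonal2 => /matrixP e.
by move: (e 0 0) (e 1 1) (e 0 1); rewrite !mul2E !one2E !mxE -!expr2.
Qed.

Lemma orthogonal_det1 A : orthogonal2 A -> \det A = 1 ->
  exists2 a, 0 < a <= 2 * pi & A = rotmx a.
Proof.
move=> /orthogonal_rows[r0 r1 r01]; rewrite det2E => d.
have e0 : A 1 1 = A 0 0.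
  have : A 1 1 = A 1 1 * (A 0 0 ^+ 2 + A 0 1 ^+ 2) by rewrite r0 mulr1.
  have -> : A 1 1 * (A 0 0 ^+ 2 + A 0 1 ^+ 2) =
    A 0 0 * (A 0 0 * A 1 1 - A 0 1 * A 1 0) +
    A 0 1 * (A 0 0 * A 1 0 + A 0 1 * A 1 1) by ring.
  by rewrite d r01 mulr1 mulr0 addr0.
have e1 : A 0 1 = - A 1 0.
  have : A 1 0 = A 1 0 * (A 0 0 ^+ 2 + A 0 1 ^+ 2) by rewrite r0 mulr1.
  have -> : A 1 0 * (A 0 0 ^+ 2 + A 0 1 ^+ 2) =
    A 0 0 * (A 0 0 * A 1 0 + A 0 1 * A 1 1)
    - A 0 1 * (A 0 0 * A 1 1 - A 0 1 * A 1 0) by ring.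
  by rewrite d r01 mulr1 mulr0 add0r => ->; rewrite opprK.
have [|a ha ca] := @unit_circ (col 0 A).
  by rewrite !mxE -e0 addrC.
exists a => //; move/colP: ca => ca; move: (ca 0) (ca 1); rewrite !circE !mxE.
by move=> ca0 ca1; apply: mx2_ext; rewrite !cmulE ?ca0 ?ca1.
Qed.

Lemma orthogonal_detN1 A : orthogonal2 A -> \det A = -1 ->
  exists a, A = rotmx a *m reflmx R.
Proof.
move=> oA dA; have [||a _ ea] := @orthogonal_det1 (A *m reflmx R).
- exact: orthogonalM orthogonal_reflmx.
- by rewrite det_mulmx dA det_reflmx mulrNN mulr1.
by exists a; rewrite -ea -mulmxA reflmxK mulmx1.
Qed.

Lemma orthogonal_circ A t : orthogonal2 A ->
  exists2 s, 0 < s <= 2 * pi & circ s = A *m circ t.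
Proof.
move=> oA; have [d|d] := det_orthogonal oA.
  have [a _ ->] := orthogonal_det1 oA d; rewrite rotmx_circ.
  exact/unit_circ/circ_unit.
have [a ->] := orthogonal_detN1 oA d; rewrite -mulmxA reflmx_circ rotmx_circ.
exact/unit_circ/circ_unit.
Qed.

Lemma time_actE A t : orthogonal2 A -> circ (time_act A t) = A *m circ t.
Proof.
move=> oA; have [s _ es] := orthogonal_circ t oA.
by apply: circK; rewrite -es circ_unit.
Qed.

(** The rotation by half of the angle takes the axis of the model reflection to
    the axis of the given one. *)
Lemma reflection_conj a :
  rotmx a *m reflmx R = rotmx (a / 2) *m reflmx R *m rotmx (- (a / 2)).
Proof.
rewrite -mulmxA reflmx_rotmx opprK mulmxA -rotmxD; congr (rotmx _ *m _).
by rewrite -mulrDr -div1r -mulrDl -(natrD _ 1 1) divff// mulr1.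
Qed.

Lemma reflection_invol a :
  (rotmx a *m reflmx R) *m (rotmx a *m reflmx R) = 1%:M.
Proof.
by rewrite mulmxA -(mulmxA (rotmx a)) reflmx_rotmx mulmxA rotmxKN mul1mx reflmxK.
Qed.

Lemma rotation_invol A : orthogonal2 A -> \det A = 1 -> A *m A = 1%:M ->
  A = 1%:M \/ A = - 1%:M.
Proof.
move=> oA dA; have [a _ ->] := orthogonal_det1 oA dA; rewrite -rotmxD => e.
have : sin a = 0.
  move/matrixP: e => /(_ 0 0); rewrite !mx2E cosD -!expr2 cos2sin2 => e.
  by apply/eqP; rewrite -sqrf_eq0; apply/eqP; lra.
move=> s0; have := cos2Dsin2 a; rewrite s0 expr0n /= addr0 => /eqP.
rewrite sqrf_eq1 => /orP[]/eqP c1; [left|right]; apply: mx2_ext;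
  by rewrite ?[in RHS]mxE !mx2E ?s0 ?c1 ?oppr0.
Qed.

End PlaneFacts.

(** * Permutations of three bodies *)

Section ThreeBodies.
Implicit Types (i j k p : 'I_3) (z t c : 'S_3).

Lemma ord3P i : [\/ i = 0, i = 1 | i = 1 + 1].
Proof.
by case: i => [[|[|[|//]]] hi]; [apply: Or31|apply: Or32|apply: Or33];
  apply: val_inj.
Qed.

Lemma third_body i j : i != j ->
  exists k, [/\ k != i, k != j & forall p, [\/ p = i, p = j | p = k]].
Proof.
move=> ij.
have [k] : exists k, (k != i) && (k != j).
  have [e|e|e] := ord3P i; have [e'|e'|e'] := ord3P j; subst i j => //;
    by [exists 0 | exists 1 | exists (1 + 1)].
move=> /andP[ki kj]; exists k; split=> // p.
move: ij ki kj; have [->|->|->] := ord3P i; have [->|->|->] := ord3P j => //;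
  have [->|->|->] := ord3P k => //; have [->|->|->] := ord3P p => // _ _ _;
  by [apply: Or31 | apply: Or32 | apply: Or33].
Qed.

Lemma tperm_neq1 i j : i != j -> tperm i j != 1%g.
Proof.
by move=> ij; apply/eqP => /permP/(_ i)/eqP; rewrite tpermL perm1 eq_sym (negPf ij).
Qed.

Lemma tperm_order i j : i != j -> #[tperm i j]%g = 2%N.
Proof.
move=> ij; apply: nt_prime_order; rewrite ?tperm_neq1//.
by rewrite !expgS expg0 mulg1 tperm2.
Qed.

Lemma perm3_fixed z i j k : i != j -> k != i -> k != j -> z k = k ->
  z = 1%g \/ z = tperm i j.
Proof.
move=> ij ki kj zk.
have [k' [k'i k'j all3]] := third_body ij.
have kk' : k = k' by have [e|e|//] := all3 k; subst k; rewrite eqxx in ki kj.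
subst k'.
have zik : z i != k by rewrite -zk (inj_eq perm_inj) eq_sym.
have zjk : z j != k by rewrite -zk (inj_eq perm_inj) eq_sym.
have zij : z i != z j by rewrite (inj_eq perm_inj).
have [zi|zi|zi] := all3 (z i); last by rewrite zi eqxx in zik.
  have [zj|zj|zj] := all3 (z j); first by rewrite zi zj eqxx in zij.
    by left; apply/permP=> p; rewrite perm1; have [->|->|->] := all3 p.
  by rewrite zj eqxx in zjk.
have [zj|zj|zj] := all3 (z j); last by rewrite zj eqxx in zjk.
  right; apply/permP=> p; have [->|->|->] := all3 p.
  - by rewrite tpermL.
  - by rewrite tpermR.
  - by rewrite tpermD// eq_sym.
by rewrite zi zj eqxx in zij.
Qed.

Lemma perm3P z : [\/ z = 1%g, exists i j, i != j /\ z = tperm i j |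
  forall i, z i != i].
Proof.
case: (pickP (fun i => z i == i)) => [k /eqP zk|zN]; last first.
  by apply: Or33 => i; rewrite zN.
have [i [j [ij ki kj]]] : exists i j, [/\ i != j, k != i & k != j].
  have [->|->|->] := ord3P k; [exists 1, (1 + 1) | exists 0, (1 + 1) | exists 0, 1];
    by split.
have [->|->] := perm3_fixed ij ki kj zk; [exact: Or31|apply: Or32].
by exists i, j.
Qed.

Lemma labelling i j k : i != j -> k != i -> k != j ->
  exists c, [/\ c 0 = i, c 1 = j & c (1 + 1) = k].
Proof.
move=> ij ki kj.
pose f p : 'I_3 := if p == 0 then i else if p == 1 then j else k.
have f_inj : injective f.
  have ji : j != i by rewrite eq_sym.
  have ik : i != k by rewrite eq_sym.
  have jk : j != k by rewrite eq_sym.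
  move=> p q; rewrite /f; have [->|->|->] := ord3P p;
    have [->|->|->] := ord3P q => //= /eqP e; exfalso; move: e; apply/negP; assumption.
by exists (perm f_inj); rewrite !permE.
Qed.

Section ThreeCycle.
Variable z : 'S_3.
Hypothesis zN : forall i, z i != i.

Lemma three_cycle_orbit i : z (z i) != i /\ z (z (z i)) = i.
Proof.
have h1 : z (z i) != i.
  apply/negP => /eqP zz.
  have [k [ki kz all3]] := third_body (zN i).
  have [e|e|e] := all3 (z k).
  - by move/perm_inj: e => e; rewrite e eqxx in kz.
  - by rewrite -[X in _ = X]zz in e; move/perm_inj: e => e; rewrite e eqxx in ki.
  - by have := zN k; rewrite e eqxx.
split=> //.
have [k [kz kzz all3]] := third_body (zN (z i)).
have [e|e|e] := all3 (z (z (z i))).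
- by have := zN (z (z i)); rewrite e eqxx.
- by move/perm_inj: e => e; rewrite e eqxx in h1.
- have [e'|e'|e'] := all3 i; last by rewrite e -e'.
    by rewrite -e' eqxx in h1.
  by have := zN i; rewrite -e' eqxx.
Qed.

(** The orbit of any body under a 3-cycle consists of all the bodies. *)
Lemma three_cycle_ind (P : 'I_3 -> Prop) i :
  P i -> P (z i) -> P (z (z i)) -> forall p, P p.
Proof.
move=> h0 h1 h2 p; have [k [ki kz all3]] := third_body (zN i).
have [->//|->//|->] := all3 p.
have [e|e|<-//] := all3 (z (z i)).
- by have := zN (z i); rewrite e eqxx.
- by have := (three_cycle_orbit i).1; rewrite e eqxx.
Qed.

(** Any body can be given the last label, and the other two are then labelled
    in the cyclic order of [z]. *)
Lemma three_cycle_frame k :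
  exists c, c (1 + 1) = k /\ (cycle123 ^ c)%g = z.
Proof.
have [zzk zzzk] := three_cycle_orbit k.
have [c [c0 c1 c2]] : exists c, [/\ c 0 = z k, c 1 = z (z k) & c (1 + 1) = k].
  by apply: labelling; rewrite // eq_sym.
exists c; split => //.
have cycE i : cycle123 i = i + 1 by rewrite permE.
apply/permP; apply: (three_cycle_ind (i := k)).
- by rewrite -{1}c2 permJ cycE -c0; congr (c _); apply: val_inj.
- by rewrite -{1}c0 permJ cycE -c1; congr (c _); apply: val_inj.
- by rewrite -{1}c1 permJ cycE zzzk.
Qed.

Lemma three_cycle_neq1 : z != 1%g.
Proof. by apply/eqP => e; have := zN 0; rewrite e perm1 eqxx. Qed.

Lemma three_cycle_cube : (z * z * z = 1)%g.
Proof. by apply/permP=> i; rewrite !permM perm1 (three_cycle_orbit i).2. Qed.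

Lemma three_cycle_order : #[z]%g = 3%N.
Proof.
apply: nt_prime_order; rewrite ?three_cycle_neq1//.
by rewrite !expgS expg0 mulg1 mulgA three_cycle_cube.
Qed.

Lemma three_cycle_frame_transp i j : i != j ->
  exists c, (transp12 ^ c = tperm i j)%g /\ (cycle123 ^ c)%g = z.
Proof.
move=> ij; have [k [ki kj all3]] := third_body ij.
have [c [c2 cz]] := three_cycle_frame k; exists c; split=> //.
rewrite /transp12 tpermJ.
have c02 : c 0 != k by rewrite -c2 (inj_eq perm_inj).
have c12 : c 1 != k by rewrite -c2 (inj_eq perm_inj).
have c01 : c 0 != c 1 by rewrite (inj_eq perm_inj).
move: c01 c02 c12.
have [->|->|->] := all3 (c 0); have [->|->|->] := all3 (c 1);
  rewrite ?eqxx // => _ _ _; exact: tpermC.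
Qed.

End ThreeCycle.

Lemma involution3P t : (t * t = 1)%g -> t = 1%g \/ exists i j, i != j /\ t = tperm i j.
Proof.
move=> tt; have [->|//|tN] := perm3P t; [by left|by right|].
have /permP/(_ 0) := three_cycle_cube tN; rewrite tt mul1g perm1 => e.
by have := tN 0; rewrite e eqxx.
Qed.

Lemma inverting_involution z t : (forall i, z i != i) ->
  (t * t = 1)%g -> (t * z * t = z^-1)%g -> exists i j, i != j /\ t = tperm i j.
Proof.
move=> zN tt tz; have [t1|//] := involution3P tt.
move: tz; rewrite t1 mul1g mulg1 => e.
have := three_cycle_cube zN; rewrite {2}e mulgV mul1g => /eqP.
by rewrite (negPf (three_cycle_neq1 zN)).
Qed.

Lemma commuting_involution t i j : i != j -> (t * tperm i j = tperm i j * t)%g ->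
  t = 1%g \/ t = tperm i j.
Proof.
move=> ij ct; have [k [ki kj all3]] := third_body ij.
apply: (perm3_fixed ij ki kj).
have sk : tperm i j k = k by rewrite tpermD // eq_sym.
have := congr1 (fun s : 'S_3 => s k) ct; rewrite !permM sk => e.
have [e'|e'|//] := all3 (t k).
  by move: e; rewrite e' tpermL => /eqP; rewrite eq_sym (negPf ij).
by move: e; rewrite e' tpermR => /eqP; rewrite (negPf ij).
Qed.

Lemma inverting_involution_transp t i j : i != j -> (t * t = 1)%g ->
  (t * tperm i j * t = (tperm i j)^-1)%g -> t = 1%g \/ t = tperm i j.
Proof.
move=> ij tt; rewrite tpermV => ts; apply: commuting_involution => //.
by rewrite -{2}ts -!mulgA tt mulg1.
Qed.

Lemma transp12_conj i j : i != j -> exists c, (transp12 ^ c = tperm i j)%g.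
Proof.
move=> ij; have [k [ki kj _]] := third_body ij.
have [c [c0 c1 _]] := labelling ij ki kj.
by exists c; rewrite tpermJ c0 c1.
Qed.

End ThreeBodies.

(** * Linear changes of variable and loops of class H^1 *)

Section Scaling.
Variable R : realType.
Notation leb := (@lebesgue_measure R).
Implicit Types (D : set R) (k a b : R).

Lemma scale_preimage_itv k a b (x y : bool) : 0 < k ->
  ( *%R k @^-1` [set` Interval (BSide x a) (BSide y b)]) =
  [set` Interval (BSide x (a / k)) (BSide y (b / k))].
Proof.
move=> k0; apply/seteqP; split=> s /=; rewrite !in_itv /=; case: x; case: y => /=;
  by rewrite ?ler_pdivrMr ?ltr_pdivrMr ?ler_pdivlMr ?ltr_pdivlMr // ![k * _]mulrC.
Qed.

Section ScaledMeasure.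
Variables (k : R) (k0 : 0 < k).

Let phi : R -> measurableTypeR R := *%R k.
Let kn : {nonneg R} := NngNum (ltW k0).

Let mphi : measurable_fun [set: R] phi.
Proof. exact: mulrl_measurable. Qed.

(** Both measures agree on half-open intervals, which determine a Borel measure. *)
Lemma lebesgue_measure_scale (A : set R) : measurable A ->
  pushforward (mscale kn leb) phi A = leb A.
Proof.
move=> mA; apply/esym/lebesgue_measure_unique => //= _ [[a b]] /= _ <-.
rewrite /pushforward /= scale_preimage_itv// /mscale lebesgue_measure_itv /=.
rewrite (lebesgue_measure_itv `](a / k), (b / k)]) /=.
rewrite !lte_fin ltr_pM2r ?invr_gt0//; case: ifP => _; last by rewrite mule0.
by rewrite -!EFinB -EFinM -mulrBl mulrC divfK// gt_eqF.
Qed.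

Lemma ge0_integral_scale D (f : R -> \bar R) : measurable D ->
  measurable_fun D f -> (forall x, D x -> 0%E <= f x)%E ->
  (\int[leb]_(s in D) f s =
   k%:E * \int[leb]_(s in *%R k @^-1` D) f (k * s)%R)%E.
Proof.
move=> mD mf f0.
have mpD : measurable (phi @^-1` D).
  by rewrite -[X in measurable X]setTI; exact: mphi.
transitivity (\int[mscale kn leb]_(s in phi @^-1` D) (f \o phi) s)%E; last first.
  rewrite ge0_integral_mscale// => [|s]; last exact: f0.
  by apply: (measurable_comp mD) => //; [move=> _ [s ? <-] | exact: measurable_funTS].
transitivity (\int[pushforward (mscale kn leb) phi]_(y in D) f y)%E.
  by apply: eq_measure_integral => //= A mA AS; exact/esym/lebesgue_measure_scale.
by rewrite ge0_integral_pushforward// => s; rewrite inE; exact: f0.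
Qed.

End ScaledMeasure.

Lemma Rintegral_scale k D (f : R -> R) : 0 < k -> measurable D ->
  leb.-integrable D (EFin \o f) ->
  \int[leb]_(s in D) f s = k * \int[leb]_(s in *%R k @^-1` D) f (k * s).
Proof.
move=> k0 mD fi; have mf := measurable_int _ fi.
have mfp := measurable_funepos mf; have mfn := measurable_funeneg mf.
rewrite /Rintegral [in LHS]integralE [in RHS]integralE.
have ep := ge0_integral_scale k0 mD mfp (fun x _ => funepos_ge0 _ x).
have en := ge0_integral_scale k0 mD mfn (fun x _ => funeneg_ge0 _ x).
have finp : (\int[leb]_(s in D) (EFin \o f)^\+ s)%E \is a fin_num.
  exact: integrable_pos_fin_num.
have finn : (\int[leb]_(s in D) (EFin \o f)^\- s)%E \is a fin_num.
  exact: integrable_neg_fin_num.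
have kfin (y : \bar R) : (k%:E * y)%E \is a fin_num -> y \is a fin_num.
  by case: y => [r//||]; rewrite ?gt0_mulye ?gt0_mulNye ?gt0_muley ?gt0_muleNy ?lte_fin.
have fp : (\int[leb]_(s in *%R k @^-1` D) (EFin \o f)^\+ (k * s)%R)%E \is a fin_num.
  by apply: kfin; rewrite -ep.
have fn : (\int[leb]_(s in *%R k @^-1` D) (EFin \o f)^\- (k * s)%R)%E \is a fin_num.
  by apply: kfin; rewrite -en.
rewrite fineB// ep en !fineM// -mulrBr; congr (_ * _).
rewrite -fineB; [|exact: fp|exact: fn]. 
congr (fine (_ - _)); apply: eq_integral => s _; by rewrite ?funeposE ?funenegE.
Qed.

End Scaling.

Section H1Facts.
Variables (R : realType) (m : 'I_3 -> R).
Notation leb := (@lebesgue_measure R).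
Implicit Types (x v : R -> conf R) (i j : 'I_3) (a : 'I_2) (s t : R).

Lemma period_ge0 : 0 <= 2 * pi :> R.
Proof. by rewrite mulr_ge0// pi_ge0. Qed.

Lemma measurable_period : measurable (@period R : set (measurableTypeR R)).
Proof. exact: measurable_itv. Qed.

Lemma lebesgue_period : leb (@period R) = (2 * pi)%:E.
Proof.
rewrite /period lebesgue_measure_itv /= lte_fin mulr_gt0// ?pi_gt0//.
by rewrite sube0.
Qed.

Lemma bounded_period_integrable (r : R) :
  leb.-integrable (@period R) (EFin \o cst r).
Proof.
apply: measurable_bounded_integrable => //.
- exact: measurable_period.
- by have := lebesgue_period; rewrite /period /= => ->; rewrite ltry.
- by apply: bounded_cst.
Qed.

Section SquareIntegrable.
Variable f : R -> R.
Hypothesis mf : measurable_fun (@period R) f.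
Hypothesis f2 : (\int[leb]_(t in @period R) (f t ^+ 2)%:E < +oo)%E.

Lemma integrable_sq : leb.-integrable (@period R) (EFin \o (fun t => f t ^+ 2)).
Proof.
apply/integrableP; split.
  by apply/measurable_EFinP; apply: measurable_funX.
by under eq_integral do rewrite /= ger0_norm ?sqr_ge0//.
Qed.

(** The period has finite length and [`|f| <= 1 + f ^+ 2]. *)
Lemma sq_integrable_integrable : leb.-integrable (@period R) (EFin \o f).
Proof.
have if2 : leb.-integrable (@period R) (EFin \o (fun t => 1 + f t ^+ 2)).
  have := integrableD measurable_period (bounded_period_integrable 1) integrable_sq.
  by apply: eq_integrable; [exact: measurable_period|].
apply: le_integrable if2; first exact: measurable_period.
  exact/measurable_EFinP.
move=> t _ /=; rewrite lee_fin [leRHS]ger0_norm; last by rewrite addr_ge0 ?sqr_ge0.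
by rewrite -[_ ^+ 2]real_normK ?num_real//; nra.
Qed.

End SquareIntegrable.

Lemma H1_sq_integrable x v : H1_loop m x v -> forall i a,
  leb.-integrable (@period R) (EFin \o (fun t => v t i a 0 ^+ 2)).
Proof.
move=> xv i a; apply: integrable_sq.
  exact: H1_measurable xv i a.
exact: H1_square_integrable xv i a.
Qed.

Lemma H1_integrable x v : H1_loop m x v -> forall i a,
  leb.-integrable (@period R) (EFin \o (fun t => v t i a 0)).
Proof.
move=> xv i a; apply: sq_integrable_integrable.
  exact: H1_measurable xv i a.
exact: H1_square_integrable xv i a.
Qed.

Lemma H1_continuous x v : H1_loop m x v -> forall i a,
  {within @period R, continuous (fun t => x t i a 0)}.
Proof.
move=> xv i a.
have := parameterized_integral_continuous period_ge0 (H1_integrable xv i a).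
move=> c; apply: (@subspace_eq_continuous _ _ _
  (fun t => x 0 i a 0 + parameterized_integral leb 0 t (fun t => v t i a 0))).
  move=> t; rewrite inE /period /= in_itv /= => t_in.
  by rewrite [RHS](H1_primitive xv i a t_in).
by move=> t; apply: cvgD; [exact: cvg_cst|exact: c].
Qed.

End H1Facts.

Section Loops.
Variables (R : realType) (m : 'I_3 -> R).
Notation leb := (@lebesgue_measure R).
Implicit Types (x v : R -> conf R) (i j : 'I_3) (a : 'I_2) (s t : R).

Lemma H1_circ x v s t : H1_loop m x v -> circ s = circ t -> x s = x t.
Proof.
move=> xv /circ_eq[k ->].
have xn n u : x (u + n%:R * (2 * pi)) = x u.
  elim: n u => [|n IH] u; first by rewrite mul0r addr0.
  by rewrite -[in RHS]IH -[in RHS](H1_periodic xv) mulrS; congr x; ring.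
case: k => n; first exact: xn.
by rewrite -[LHS](xn n.+1); congr x; rewrite NegzE mulrNz; ring.
Qed.

(** Both times are brought modulo [2 * pi] into the period, where the
    intermediate value theorem applies. *)
Lemma circle_sign_change (f : R -> R) s t :
  {within @period R, continuous f} ->
  (forall s' t', circ s' = circ t' -> f s' = f t') ->
  f s = - f t -> exists u, f u = 0.
Proof.
move=> cf fc.
have [s' /andP[s0 s2] es] := @unit_circ R _ (circ_unit s).
have [t' /andP[t0 t2] et] := @unit_circ R _ (circ_unit t).
rewrite -(fc _ _ es) -(fc _ _ et) => {s t es et}.
wlog st : s' t' s0 s2 t0 t2 / s' <= t'.
  move=> W e; have [st|ts] := leP s' t'; first exact: (W s' t').
  by apply: (W t' s') => //; [exact: ltW|rewrite e opprK].
move=> e; have [||c _ fc0] := @IVT _ f s' t' 0 st.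
- apply: continuous_subspaceW cf => u /=; rewrite /period /= !in_itv /= => /andP[u1 u2].
  by rewrite (le_trans (ltW s0) u1) (le_trans u2 t2).
- by rewrite e ge_min le_max; have [h|/ltW h] := leP 0 (f t'); rewrite ?h ?oppr_le0 ?oppr_ge0 ?h ?orbT.
by exists c.
Qed.

Lemma within_continuous_sum (I : Type) (r : seq I) (A : set R) (f : I -> R -> R) :
  (forall k, {within A, continuous (f k)}) ->
  {within A, continuous (fun t => \sum_(k <- r) f k t)}.
Proof.
move=> cf t; elim: r => [|k r' IH].
  by under eq_fun do rewrite big_nil; exact: cvg_cst.
under eq_fun do rewrite big_cons.
by apply: cvgD; [exact: cf|exact: IH].
Qed.

Section OneLoop.
Variables (x v : R -> conf R).
Hypothesis xv : H1_loop m x v.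

Lemma H1_diff_continuous i j a :
  {within @period R, continuous (fun t => x t i a 0 - x t j a 0)}.
Proof. by move=> t; apply: cvgB; exact: H1_continuous xv _ _ t. Qed.

Lemma H1_bounded : exists2 B, 0 <= B &
  forall t i a, period t -> `|x t i a 0| <= B.
Proof.
pose f t := \sum_i \sum_a `|x t i a 0|.
have [|c _ fc] := @EVT_max R f 0 (2 * pi) (period_ge0 R).
  apply: within_continuous_sum => i; apply: within_continuous_sum => a t.
  by apply: cvg_norm; exact: H1_continuous xv i a t.
exists (f c); first by apply: sumr_ge0 => i _; apply: sumr_ge0.
move=> t i a /fc; apply: le_trans.
rewrite /f (bigD1 i)//= (bigD1 a)//= -addrA lerDl addr_ge0//.
  by apply: sumr_ge0.
by apply: sumr_ge0 => j _; apply: sumr_ge0.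
Qed.

Lemma enorm_eq0 (u : 'cV[R]_2) : enorm u = 0 -> u = 0.
Proof.
rewrite /enorm => /eqP; rewrite sqrtr_eq0 sum2E => h.
by apply: sumsq_eq0; apply/eqP; rewrite eq_le h addr_ge0 ?sqr_ge0.
Qed.

Lemma coord_le_enorm (u : 'cV[R]_2) a : `|u a 0| <= enorm u.
Proof.
rewrite /enorm -sqrtr_sqr ler_wsqrtr// (bigD1 a)//= lerDl.
by apply: sumr_ge0 => b _; exact: sqr_ge0.
Qed.

Lemma distance_lower_bound i j : (forall t, x t i != x t j) ->
  exists2 e, 0 < e & forall t, period t -> e <= enorm (x t i - x t j).
Proof.
move=> ij; pose f t := \sum_a (x t i a 0 - x t j a 0) ^+ 2.
have ef t : enorm (x t i - x t j) = Num.sqrt (f t).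
  by congr Num.sqrt; apply: eq_bigr => a _; rewrite !mxE.
have [|c _ fc] := @EVT_min R f 0 (2 * pi) (period_ge0 R).
  apply: within_continuous_sum => a t.
  have c := @H1_diff_continuous i j a; exact: (cvgM (c t) (c t)).
exists (Num.sqrt (f c)); last by move=> t /fc tc; rewrite ef ler_wsqrtr.
rewrite -ef lt_def sqrtr_ge0 andbT; apply: contra (ij c) => /eqP/enorm_eq0/eqP.
by rewrite subr_eq0.
Qed.

Variable xi : conf R.

(** Either [xi] does not separate the two bodies, and their distance is the one
    along [x], or it separates them along some coordinate, and their distance
    grows with [l] because [x] is bounded. *)
Lemma translated_distance_lower_bound i j : (forall t, x t i != x t j) ->
  exists2 e, 0 < e & \forall l \near +oo, forall t, period t ->
    e <= enorm (x t i + l *: xi i - (x t j + l *: xi j)).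
Proof.
move=> ij; have [e|] := eqVneq (xi i) (xi j).
  have [d d0 dP] := distance_lower_bound ij; exists d => //; near=> l.
  by move=> t tp; rewrite e opprD addrACA addrN addr0; exact: dP.
move=> xi_ij; have [a xia] : exists a, xi i a 0 != xi j a 0.
  apply/existsP; apply: contraNT xi_ij; rewrite negb_exists => /forallP e.
  apply/eqP/colP => a; apply/eqP; exact: (negbNE (e a)).
have [B B0 xB] := H1_bounded; exists 1 => //.
pose h := `|xi i a 0 - xi j a 0|.
have h0 : 0 < h by rewrite normr_gt0 subr_eq0.
near=> l => t tp; apply: le_trans (coord_le_enorm _ a); rewrite !mxE.
have -> : x t i a 0 + l * xi i a 0 - (x t j a 0 + l * xi j a 0) =
  l * (xi i a 0 - xi j a 0) - (x t j a 0 - x t i a 0) by ring.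
apply: le_trans (lerB_dist _ _); rewrite normrM -/h.
have l_ge : (1 + 2 * B) / h <= l by near: l; apply: nbhs_pinfty_ge; exact: num_real.
rewrite ler_pdivrMr// in l_ge.
have l0 : 0 <= l by near: l; apply: nbhs_pinfty_ge; exact: num_real.
rewrite (ger0_norm l0).
have := ler_normB (x t j a 0) (x t i a 0).
by have := xB t i a tp; have := xB t j a tp; lra.
Unshelve. all: by end_near. Qed.

Lemma translated_coord_lower_bound i a (K : R) : xi i a 0 != 0 ->
  \forall l \near +oo, forall t, period t -> K <= `|x t i a 0 + l * xi i a 0|.
Proof.
move=> xia; have [B B0 xB] := H1_bounded.
have h0 : 0 < `|xi i a 0| by rewrite normr_gt0.
near=> l => t tp; rewrite addrC -[x t i a 0]opprK.
apply: le_trans (lerB_dist _ _); rewrite normrM normrN.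
have l_ge : (K + B) / `|xi i a 0| <= l by near: l; apply: nbhs_pinfty_ge; exact: num_real.
rewrite ler_pdivrMr// in l_ge.
have l0 : 0 <= l by near: l; apply: nbhs_pinfty_ge; exact: num_real.
by rewrite (ger0_norm l0); have := xB t i a tp; lra.
Unshelve. all: by end_near. Qed.

End OneLoop.
End Loops.

Section LoopsInLambda.
Variables (R : realType) (m : 'I_3 -> R).
Notation leb := (@lebesgue_measure R).
Implicit Types (x v : R -> conf R) (i j : 'I_3) (a : 'I_2) (s t : R).

Lemma H1_translate x v (xi : conf R) : H1_loop m x v -> centred m xi ->
  H1_loop m (fun t i => x t i + xi i) v.
Proof.
move=> xv c; split.
- by move=> t; rewrite (H1_periodic xv).
- move=> t; rewrite /centred; under eq_bigr do rewrite scalerDr.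
  by rewrite big_split /= (H1_centred xv) c addr0.
- exact: H1_measurable xv.
- exact: H1_square_integrable xv.
- by move=> i a t t_in; rewrite !mxE (H1_primitive xv i a t_in) addrAC.
Qed.

(** The stretched loop closes up after [2 * pi] because [x] does so after
    [2 * pi / n]; the conditions on its velocity follow by a linear change of
    variable. *)
Lemma H1_stretch x v (n : nat) : (0 < n)%N -> H1_loop m x v ->
  (forall t, x (t + 2 * pi / n%:R) = x t) ->
  H1_loop m (fun t => x (n%:R^-1 * t)) (fun t i => n%:R^-1 *: v (n%:R^-1 * t) i).
Proof.
move=> n_gt0 xv xper; have n0 : 0 < n%:R :> R by rewrite ltr0n.
have n1 : 1 <= n%:R :> R by rewrite ler1n.
have p0 := period_ge0 R.
have sub_period t : t <= 2 * pi -> [set` `[0, n%:R^-1 * t]] `<=` @period R.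
  move=> t2 s; rewrite /period /= !in_itv /= => /andP[-> /le_trans]; apply.
  by rewrite ler_pdivrMl//; nra.
have pre t : *%R n%:R @^-1` [set` `[0, t]] = [set` `[0, n%:R^-1 * t]].
  by rewrite scale_preimage_itv// mul0r mulrC.
have mw i a : measurable_fun (@period R) (fun t => (n%:R^-1 *: v (n%:R^-1 * t) i) a 0).
  under eq_fun do rewrite mxE.
  apply: measurable_funM; first exact: measurable_cst.
  apply: (@measurable_comp _ _ _ _ _ _ (@period R) (fun s => v s i a 0)
    (@period R) (fun t => n%:R^-1 * t)).
  - exact: measurable_itv.
  - move=> _ [t /= tp <-]; move: tp; rewrite /period /= !in_itv /= => /andP[t0 t2].
    by rewrite mulr_ge0 ?invr_ge0 ?ler0n//= ler_pdivrMl//; nra.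
  - exact: H1_measurable xv i a.
  - exact: mulrl_measurable.
have wsq i a : (\int[leb]_(t in @period R) (((n%:R^-1 *: v (n%:R^-1 * t) i) a 0) ^+ 2)%:E < +oo)%E.
  rewrite (ge0_integral_scale n0) /period; last 3 first.
  - exact: measurable_itv.
  - by apply/measurable_EFinP; apply: measurable_funX; exact: mw.
  - by move=> t _; rewrite lee_fin sqr_ge0.
  rewrite pre; apply: lte_mul_pinfty; rewrite ?lee_fin ?ler0n//.
  apply: le_lt_trans (H1_square_integrable xv i a).
  have msq : measurable_fun (@period R) (fun t => (v t i a 0 ^+ 2)%:E).
    by apply/measurable_EFinP; apply: measurable_funX; exact: H1_measurable xv i a.
  apply: (@le_trans _ _ (\int[leb]_(t in `[0%R, (n%:R^-1 * (2 * pi))%R]) (v t i a 0 ^+ 2)%:E)%E).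
    apply: ge0_le_integral.
    - exact: measurable_itv.
    - by move=> t _; rewrite lee_fin sqr_ge0.
    - apply: (measurable_funS _ (sub_period _ (lexx _))); first exact: measurable_itv.
      apply/measurable_EFinP; apply: measurable_funX.
      under eq_fun do rewrite mulKf ?gt_eqF// mxE.
      by apply: measurable_funM; [exact: measurable_cst|exact: H1_measurable xv i a].
    - by apply: (measurable_funS _ (sub_period _ (lexx _))) => //; exact: measurable_itv.
    - move=> t _; rewrite mulKf ?gt_eqF// mxE lee_fin exprMn ler_piMl ?sqr_ge0//.
      by rewrite expr_le1// ?invr_ge0 ?ler0n// invf_le1.
  apply: ge0_subset_integral => //; [exact: measurable_itv..| |exact: sub_period].
  by move=> t _; rewrite lee_fin sqr_ge0.
split=> //.
- by move=> t; rewrite mulrDr [n%:R^-1 * (2 * pi)]mulrC xper.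
- by move=> t; exact: H1_centred xv _.
- move=> i a t /andP[t0 t2]; rewrite mulr0.
  have wi : leb.-integrable (@period R)
      (EFin \o (fun t => (n%:R^-1 *: v (n%:R^-1 * t) i) a 0)).
    by apply: sq_integrable_integrable; [exact: mw|exact: wsq].
  rewrite (Rintegral_scale n0); last 2 first.
  - exact: measurable_itv.
  - apply: (integrableS (@measurable_period R) _ _ wi); first exact: measurable_itv.
    move=> s; rewrite /period /= !in_itv /= => /andP[-> /le_trans]; exact.
  rewrite pre (H1_primitive xv i a); last first.
    by rewrite mulr_ge0 ?invr_ge0 ?ler0n//= ler_pdivrMl//; nra.
  congr (_ + _); transitivity
    (n%:R * \int[leb]_(s in `[0, n%:R^-1 * t]) (n%:R^-1 * v s i a 0)); last first.
    by congr (_ * _); apply: eq_Rintegral => s _; rewrite mulKf ?gt_eqF// mxE.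
  rewrite RintegralZl; last 2 first.
  - exact: measurable_itv.
  - apply: (integrableS (@measurable_period R) _ _ (H1_integrable xv i a)).
      exact: measurable_itv.
    exact: sub_period.
  by rewrite mulVKf// gt_eqF.
Qed.

End LoopsInLambda.

(** * Groups that fix a configuration are not coercive *)

Section NonCoercive.
Variables (R : realType) (m : 'I_3 -> R) (alpha : R).
Hypotheses (m_gt0 : forall i, 0 < m i) (alpha_gt0 : 0 < alpha).
Notation leb := (@lebesgue_measure R).
Implicit Types (x v : R -> conf R) (i j : 'I_3) (a : 'I_2) (s t : R).

Lemma enorm_sqr (u : 'cV[R]_2) : enorm u ^+ 2 = \sum_a u a 0 ^+ 2.
Proof. by rewrite sqr_sqrtr//; apply: sumr_ge0 => a _; exact: sqr_ge0. Qed.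

Lemma enorm_ge0 (u : 'cV[R]_2) : 0 <= enorm u.
Proof. exact: sqrtr_ge0. Qed.

Lemma potential_ge0 (y : conf R) : (0 <= potential m alpha y)%E.
Proof.
rewrite /potential; case: ifP => // _; rewrite lee_fin.
apply: sumr_ge0 => i _; apply: sumr_ge0 => j _.
by rewrite divr_ge0 ?powR_ge0// mulr_ge0// ltW.
Qed.

Lemma collision_freeP (y : conf R) :
  reflect (forall i j, i != j -> y i != y j) (~~ collision y).
Proof.
apply: (iffP idP) => [nc i j ij|nc].
  apply: contra nc => xij; apply/existsP; exists i; apply/existsP; exists j.
  by rewrite ij.
by apply/existsP => -[i /existsP[j /andP[ij]]]; apply/negP; exact: nc.
Qed.

Lemma H1_coord_integrable x v i a : H1_loop m x v ->
  leb.-integrable (@period R) (EFin \o (fun t => x t i a 0)).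
Proof.
move=> xv; apply: continuous_compact_integrable; first exact: segment_compact.
exact: H1_continuous xv i a.
Qed.

Lemma H1_coord_measurable x v i a : H1_loop m x v ->
  measurable_fun (@period R) (fun t => x t i a 0).
Proof.
by move=> xv; apply/measurable_EFinP; exact: measurable_int (H1_coord_integrable i a xv).
Qed.

Lemma potential_measurable x v : H1_loop m x v ->
  (forall t, period t -> ~~ collision (x t)) ->
  measurable_fun (@period R) (fun t => potential m alpha (x t)).
Proof.
move=> xv nc.
apply: (@eq_measurable_fun _ _ _ _ _ (fun t => (\sum_(i < 3) \sum_(j < 3 | (i < j)%N)
     m i * m j * enorm (x t i - x t j) `^ (- alpha))%:E)).
  move=> t; rewrite inE => /nc /negPf tc; rewrite /potential tc; congr EFin.
  by apply: eq_bigr => i _; apply: eq_bigr => j _; rewrite powRN.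
apply/measurable_EFinP.
apply: measurable_sum => i; under eq_fun do rewrite big_mkcond.
apply: measurable_sum => j; case: (i < j)%N; last exact: measurable_cst.
apply: measurable_funM; first exact: measurable_cst.
apply: (measurableT_comp (measurable_powR _)).
apply: (measurableT_comp (f := @Num.sqrt R)).
  by apply: continuous_measurable_fun; exact: sqrt_continuous.
apply: measurable_sum => a; apply: measurable_funX.
under eq_fun do rewrite !mxE.
apply: measurable_funB; exact: H1_coord_measurable xv.
Qed.

Lemma integrable_period_sum (I : finType) (f : I -> R -> R) :
  (forall k, leb.-integrable (@period R) (EFin \o f k)) ->
  leb.-integrable (@period R) (EFin \o (fun t => \sum_k f k t)).
Proof.
move=> fi; have := @integrable_sum _ _ _ leb (@period R) (@measurable_period R) _
  (index_enum I) xpredT (fun k t => (f k t)%:E) (fun k _ => fi k).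
by apply: eq_integrable; [exact: measurable_period|move=> t _; rewrite /= sumEFin].
Qed.

Lemma integrable_period_add (f g : R -> R) :
  leb.-integrable (@period R) (EFin \o f) ->
  leb.-integrable (@period R) (EFin \o g) ->
  leb.-integrable (@period R) (EFin \o (fun t => f t + g t)).
Proof.
move=> fi gi; have := integrableD (@measurable_period R) fi gi.
by apply: eq_integrable; first exact: measurable_period.
Qed.

Lemma H1_norm_integrable x v : H1_loop m x v ->
  leb.-integrable (@period R)
    (EFin \o (fun t => \sum_(i < 3) (enorm (x t i) ^+ 2 + enorm (v t i) ^+ 2))).
Proof.
move=> xv; apply: integrable_period_sum => i.
apply: (@eq_integrable _ _ _ _ _ (@measurable_period R)
  (EFin \o (fun t => \sum_a x t i a 0 ^+ 2 + \sum_a v t i a 0 ^+ 2))).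
  by move=> t _; rewrite /= !enorm_sqr.
apply: integrable_period_add; apply: integrable_period_sum => a.
  apply: continuous_compact_integrable; first exact: segment_compact.
  have c := @H1_continuous _ _ _ _ xv i a; move=> t; exact: (cvgM (c t) (c t)).
exact: H1_sq_integrable xv i a.
Qed.

Lemma kinetic0E x v t :
  \sum_(i < 3) 2^-1 * m i * enorm (v t i - Jmx R *m (0 *: x t i)) ^+ 2 =
  \sum_(i < 3) \sum_a 2^-1 * m i * v t i a 0 ^+ 2.
Proof.
by apply: eq_bigr => i _; rewrite scale0r mulmx0 subr0 enorm_sqr mulr_sumr.
Qed.

Lemma kinetic_integrable x v : H1_loop m x v -> leb.-integrable (@period R)
  (EFin \o (fun t => \sum_(i < 3) \sum_a 2^-1 * m i * v t i a 0 ^+ 2)).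
Proof.
move=> xv; apply: integrable_period_sum => i; apply: integrable_period_sum => a.
have := integrableZl (@measurable_period R) (2^-1 * m i) (H1_sq_integrable xv i a).
by apply: eq_integrable; first exact: measurable_period.
Qed.

(** The bound involves the loop through its velocity only, so that it is the same
    for all the translates of a loop on which the potential stays below [C]. *)
Lemma action_le x v (C : R) : H1_loop m x v ->
  (forall t, period t -> ~~ collision (x t)) ->
  (forall t, period t -> potential m alpha (x t) <= C%:E)%E ->
  (action_functional m alpha 0 x v <=
   \int[leb]_(t in @period R)
     ((\sum_(i < 3) \sum_a 2^-1 * m i * v t i a 0 ^+ 2) + C)%:E)%E.
Proof.
move=> xv nc xC; have mk := measurable_int _ (kinetic_integrable xv).
have k0 t : 0 <= \sum_(i < 3) \sum_a 2^-1 * m i * v t i a 0 ^+ 2.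
  apply: sumr_ge0 => i _; apply: sumr_ge0 => a _.
  by rewrite mulr_ge0 ?sqr_ge0// mulr_ge0 ?invr_ge0 ?ler0n// ltW.
rewrite /action_functional; under eq_integral do rewrite kinetic0E.
apply: ge0_le_integral.
- exact: measurable_period.
- by move=> t _; rewrite adde_ge0 ?potential_ge0// lee_fin.
- by apply: emeasurable_funD => //; exact: potential_measurable xv nc.
- apply/measurable_EFinP; apply: measurable_funD; last exact: measurable_cst.
  exact/measurable_EFinP.
- by move=> t tp; rewrite EFinD leeD2l// xC.
Qed.

Lemma H1_norm_ge x v i a (K : R) : H1_loop m x v -> 0 <= K ->
  (forall t, period t -> K <= `|x t i a 0|) -> K <= H1_norm x v.
Proof.
move=> xv K0 xK; rewrite /H1_norm -[leLHS]ger0_norm// -sqrtr_sqr ler_wsqrtr//.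
apply: (@le_trans _ _ (\int[leb]_(t in @period R) (K ^+ 2))).
  rewrite Rintegral_cst; last exact: measurable_period.
  rewrite [fine _](_ : _ = 2 * pi); last by exact: (congr1 fine (lebesgue_period R)).
  by rewrite ler_peMr ?sqr_ge0//; have := pi_ge2 R; lra.
apply: le_Rintegral.
- exact: measurable_period.
- exact: bounded_period_integrable.
- exact: H1_norm_integrable xv.
move=> t /xK xt; rewrite (bigD1 i)//= -addrA.
apply: (@le_trans _ _ (enorm (x t i) ^+ 2)).
  rewrite ler_pXn2r ?nnegrE ?enorm_ge0//.
  exact: le_trans xt (coord_le_enorm _ _).
by rewrite lerDl addr_ge0 ?sqr_ge0// sumr_ge0// => j _; rewrite addr_ge0 ?sqr_ge0.
Qed.

Lemma translated_potential_bound x v (xi : conf R) : H1_loop m x v ->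
  (forall t, ~~ collision (x t)) ->
  exists C : R, \forall l \near +oo, forall t, period t ->
    ~~ collision (fun i => x t i + l *: xi i) /\
    (potential m alpha (fun i => x t i + l *: xi i)%R <= C%:E)%E.
Proof.
move=> xv nc.
have /choice[e eP] : forall p : 'I_3 * 'I_3, exists e, 0 < e /\
    (p.1 != p.2 -> \forall l \near +oo, forall t, period t ->
       e <= enorm (x t p.1 + l *: xi p.1 - (x t p.2 + l *: xi p.2))).
  move=> [i j] /=; have [->|ij] := eqVneq i j; first by exists 1.
  have [|e e0 eP] := @translated_distance_lower_bound _ _ _ _ xv xi i j.
    by move=> t; exact: (collision_freeP _ (nc t)).
  by exists e.
exists (\sum_(i < 3) \sum_(j < 3 | (i < j)%N) m i * m j / e (i, j) `^ alpha).
have far : \forall l \near +oo, forall (p : 'I_3 * 'I_3), p.1 != p.2 ->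
    forall t, period t ->
       e p <= enorm (x t p.1 + l *: xi p.1 - (x t p.2 + l *: xi p.2)).
  apply: filter_forall => p; have [pp|pp] := eqVneq p.1 p.2; first by near=> l.
  by have := (eP p).2 pp; apply: filterS => l h _.
near=> l => t tp.
have far_l : forall (p : 'I_3 * 'I_3), p.1 != p.2 -> forall t, period t ->
       e p <= enorm (x t p.1 + l *: xi p.1 - (x t p.2 + l *: xi p.2)) by near: l; exact: far.
have free : ~~ collision (fun i => x t i + l *: xi i).
  apply/collision_freeP => i j ij; apply/eqP => xij.
  have := far_l (i, j) ij t tp; rewrite /= xij subrr.
  rewrite /enorm big1 ?sqrtr0; last by move=> a _; rewrite mxE expr0n.
  by rewrite leNgt (eP (i, j)).1.
split=> //; rewrite /potential (negPf free) lee_fin.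
apply: ler_sum => i _; apply: ler_sum => j ij.
have e0 := (eP (i, j)).1.
have ineq : i != j by apply: contraTneq ij => ->; rewrite ltnn.
apply: ler_wpM2l; first by rewrite mulr_ge0// ltW.
rewrite lef_pV2 ?posrE ?powR_gt0//; last by apply: lt_le_trans e0 (far_l (i, j) ineq t tp).
apply: ge0_ler_powR; last exact: (far_l (i, j) ineq t tp).
- exact: ltW.
- by rewrite nnegrE ltW.
- by rewrite nnegrE enorm_ge0.
Unshelve. all: by end_near. Qed.

(** The equivariant loops [x + l *: xi] have the kinetic energy of [x] and,
    for large [l], a bounded potential: bodies that [xi] separates are far apart
    and the others move as in [x]. *)
Lemma fixed_conf_not_coercive (gT : finGroupType) (G : sym_data R gT) x v
    (xi : conf R) :
  H1_loop m x v -> equivariant_loops m G x -> (forall t, ~~ collision (x t)) ->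
  centred m xi -> (forall g, conf_act G g xi = xi) -> (exists i, xi i != 0) ->
  ~ coercive m alpha G.
Proof.
move=> xv [_ xG] nc cxi fxi [i xi_i] coer.
have [a xia] : exists a, xi i a 0 != 0.
  apply/existsP; apply: contraNT xi_i; rewrite negb_exists => /forallP e.
  by apply/eqP/colP => a; rewrite mxE; apply/eqP; exact: (negbNE (e a)).
have [C C_near] := translated_potential_bound xi xv nc.
pose bound t := (\sum_(i < 3) \sum_a 2^-1 * m i * v t i a 0 ^+ 2) + C.
have ib : leb.-integrable (@period R) (EFin \o bound).
  apply: integrable_period_add; first exact: kinetic_integrable xv.
  exact: bounded_period_integrable.
have [K KP] := coer (fine (\int[leb]_(t in @period R) (bound t)%:E) + 1).
have [l [l_pot l_norm]] : exists l, (forall t, period t ->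
    ~~ collision (fun i => x t i + l *: xi i) /\
    (potential m alpha (fun i => x t i + l *: xi i)%R <= C%:E)%E) /\
    (forall t, period t -> `|K| <= `|x t i a 0 + l *: xi i a 0|).
  apply: (@filter_ex _ (@pinfty_nbhs R)); apply: filterI C_near _.
  exact: translated_coord_lower_bound xv _ _ _ _ xia.
pose y t j := x t j + l *: xi j.
have yv : H1_loop m y v.
  apply: (@H1_translate _ _ _ _ (fun j => l *: xi j) xv).
  rewrite /centred; under eq_bigr do rewrite scalerA mulrC -scalerA.
  by rewrite -scaler_sumr cxi scaler0.
have yG : equivariant_loops m G y.
  split; first by exists v.
  move=> g; apply/funext => t; apply/funext => j; rewrite /loop_act /conf_act /y.
  rewrite mulmxDr -scalemxAr; congr (_ + _ *: _).
    by have /(congr1 (fun z => z t j)) := xG g.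
  by have /(congr1 (fun z => z j)) := fxi g.
have : K <= H1_norm y v.
  apply: le_trans (ler_norm K) _; apply: (H1_norm_ge (i := i) (a := a)) => // t tp.
  by rewrite /y !mxE; exact: l_norm.
move=> /(KP _ _ yv yG); apply/negP; rewrite -ltNge.
apply: (@le_lt_trans _ _ (\int[leb]_(t in @period R) (bound t)%:E)%E).
  by apply: action_le => // t tp; have [] := l_pot t tp.
have bfin : (\int[leb]_(t in @period R) (bound t)%:E)%E \is a fin_num.
  by apply: integrable_fin_num ib; exact: measurable_period.
by rewrite EFinD fineK// lteDl// lte01.
Qed.

End NonCoercive.

(** * Symmetry groups acting on configurations *)

Section PlaneVectors.
Variable R : realType.
Implicit Types (A : 'M[R]_2) (u w e : 'cV[R]_2).

Lemma rotation_fixed A u : orthogonal2 A -> \det A = 1 -> A != 1%:M ->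
  A *m u = u -> u = 0.
Proof.
move=> oA dA A1; have [a _ Aa] := orthogonal_det1 oA dA; subst A.
move=> /colP h; move: (h 0) (h 1); rewrite !mx2E => {h} h0 h1.
have cs := cos2Dsin2 a.
have c1 : cos a != 1.
  apply: contra A1 => /eqP c1; apply/eqP.
  have s0 : sin a = 0 by apply/eqP; rewrite -sqrf_eq0; apply/eqP; rewrite c1 in cs; lra.
  by apply: mx2_ext; rewrite !mx2E ?c1 ?s0 ?oppr0.
have c1' : 2 - 2 * cos a != 0 by apply: contra c1 => /eqP ?; apply/eqP; lra.
apply: cV2_ext; rewrite !mxE; apply: (mulfI c1'); rewrite mulr0; nra.
Qed.

(** A sigma type, so that the multiplier can be chosen as a function of time. *)
Lemma cmul_transitive w u : w != 0 ->
  {c : R * R | cmul c.1 c.2 *m w = u}.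
Proof.
move=> w0; pose n := w 0 0 ^+ 2 + w 1 0 ^+ 2.
have n0 : n != 0.
  by apply: contra w0 => /eqP n0; apply/eqP/sumsq_eq0.
exists ((w 0 0 * u 0 0 + w 1 0 * u 1 0) / n, (w 0 0 * u 1 0 - w 1 0 * u 0 0) / n).
by apply: cV2_ext; rewrite !mx2E /=; move: n0; rewrite /n => n0; field.
Qed.

Definition dot u w : R := u 0 0 * w 0 0 + u 1 0 * w 1 0.

(** The vector [e] is a unit vector orthogonal to the axis of [A]. *)
Lemma reflection_axis A : orthogonal2 A -> \det A = -1 ->
  exists e, [/\ e != 0, A *m e = - e & forall w, A *m w = - w -> w = dot e w *: e].
Proof.
move=> oA dA; have [a ->] := orthogonal_detN1 oA dA.
pose e2 : 'cV[R]_2 := \col_i (i == 1)%:R.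
have e2E : (e2 0 0 = 0) * (e2 1 0 = 1) by rewrite !mxE.
have re2 : reflmx R *m e2 = - e2.
  by apply: cV2_ext; rewrite !mx2E [in RHS]mxE !e2E; ring.
have refl_anti w : reflmx R *m w = - w -> w = w 1 0 *: e2.
  move=> /colP h; move: (h 0); rewrite !mx2E !mxE => h0.
  by apply: cV2_ext; rewrite !mxE ?mulr1 ?mulr0 //; lra.
have r1 := rotmxNK (a / 2); have cs := cos2Dsin2 (a / 2).
exists (rotmx (a / 2) *m e2); split.
- apply/eqP => /(congr1 (mulmx (rotmx (- (a / 2))))); rewrite mulmxA r1 mul1mx mulmx0.
  by move=> /colP/(_ 1)/eqP; rewrite e2E mxE oner_eq0.
- by rewrite reflection_conj -!mulmxA (mulmxA (rotmx (- _))) r1 mul1mx re2 mulmxN.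
move=> w; rewrite reflection_conj -!mulmxA => /(congr1 (mulmx (rotmx (- (a / 2))))).
rewrite !mulmxA r1 mul1mx -mulmxA mulmxN => /refl_anti e.
have -> : dot (rotmx (a / 2) *m e2) w = (rotmx (- (a / 2)) *m w) 1 0.
  by rewrite /dot !mx2E !e2E sinN cosN; ring.
by rewrite scalemxAr -e mulmxA rotmxKN mul1mx.
Qed.

Lemma orthogonal_dot A u w : orthogonal2 A -> dot (A *m u) (A *m w) = dot u w.
Proof.
move=> /mulmx1C/matrixP o; move: (o 0 0) (o 0 1) (o 1 1).
rewrite /dot !mul2E !one2E !mxE => o00 o01 o11.
have -> : (A 0 0 * u 0 0 + A 0 1 * u 1 0) * (A 0 0 * w 0 0 + A 0 1 * w 1 0) +
  (A 1 0 * u 0 0 + A 1 1 * u 1 0) * (A 1 0 * w 0 0 + A 1 1 * w 1 0) =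
  (A 0 0 * A 0 0 + A 1 0 * A 1 0) * (u 0 0 * w 0 0) +
  (A 0 0 * A 0 1 + A 1 0 * A 1 1) * (u 0 0 * w 1 0 + u 1 0 * w 0 0) +
  (A 0 1 * A 0 1 + A 1 1 * A 1 1) * (u 1 0 * w 1 0) by ring.
by rewrite o00 o01 o11; ring.
Qed.

End PlaneVectors.

Lemma sum3E (V : nmodType) (F : 'I_3 -> V) i j k : i != j -> k != i -> k != j ->
  \sum_p F p = F i + F j + F k.
Proof.
move=> ij ki kj; rewrite (bigD1 i)//= (bigD1 j)//=; last by rewrite eq_sym.
rewrite (bigD1 k)//= ?ki// big1 ?addr0 ?addrA// => p /andP[/andP[pi pj] pk].
have [k' [k'i k'j all3]] := third_body ij.
have kk' : k = k' by have [e|e|//] := all3 k; subst k; rewrite eqxx in ki kj.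
by have [e|e|e] := all3 p; rewrite e ?eqxx // -?kk' ?eqxx in pi pj pk.
Qed.

Section SymmetryGroupFacts.
Variables (R : realType) (m : 'I_3 -> R) (gT : finGroupType) (G : sym_data R gT).
Hypothesis G_sym : symmetry_group m G.
Implicit Types (g h c : gT) (x v : R -> conf R) (s t : R).

Let unit1 (A : 'M[R]_2) : orthogonal2 A -> A *m A = A -> A = 1%:M.
Proof. by move=> oA AA; rewrite -[A]mulmx1 -{1}oA mulmxA AA oA. Qed.

Lemma tau1 : tau G 1%g = 1%:M.
Proof.
apply: unit1; first exact: tau_orthogonal G_sym _.
by rewrite -(tau_hom G_sym) mulg1.
Qed.

Lemma rho1 : rho G 1%g = 1%:M.
Proof.
apply: unit1; first exact: rho_orthogonal G_sym _.
by rewrite -(rho_hom G_sym) mulg1.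
Qed.

Lemma sigmaM g h : sigma G (g * h)%g = (sigma G h * sigma G g)%g.
Proof. by apply/permP => i; rewrite (sigma_hom G_sym) permM. Qed.

Lemma sigma1 : sigma G 1%g = 1%g.
Proof. by apply: (@mulgI _ (sigma G 1%g)); rewrite -sigmaM !mulg1. Qed.

Lemma tauV g : tau G g^-1 *m tau G g = 1%:M.
Proof. by rewrite -(tau_hom G_sym) mulVg tau1. Qed.

Lemma conf_actM g h (y : conf R) :
  conf_act G (g * h)%g y = conf_act G g (conf_act G h y).
Proof.
apply/funext => i; rewrite /conf_act (rho_hom G_sym) mulmxA.
by rewrite invMg (sigma_hom G_sym).
Qed.

Lemma conf_act_fixed g (y : conf R) :
  (forall i, y (sigma G g i) = rho G g *m y i) -> conf_act G g y = y.
Proof.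
move=> h; apply/funext => i; rewrite /conf_act -h -(sigma_hom G_sym).
by rewrite mulgV sigma1 perm1.
Qed.

Section Equivariant.
Variables (x : R -> conf R).
Hypothesis xG : equivariant_loops m G x.

(** Equivariance without inverses and without the choice of representatives made
    by [time_act]: the body [sigma g i] at the time [g t] is the image by
    [rho g] of the body [i] at the time [t]. *)
Lemma equivariant_at g s t i : circ s = tau G g *m circ t ->
  x s (sigma G g i) = rho G g *m x t i.
Proof.
move=> st; have [[v xv] /(_ g)/(congr1 (fun y => y s (sigma G g i))) <-] := xG.
rewrite /loop_act /conf_act -(sigma_hom G_sym) mulVg sigma1 perm1.
rewrite (@H1_circ _ _ _ _ _ t xv)// time_actE; last exact: tau_orthogonal G_sym _.
by rewrite st mulmxA tauV mul1mx.
Qed.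

Lemma equivariant_core g t i : tau G g = 1%:M ->
  x t (sigma G g i) = rho G g *m x t i.
Proof. by move=> g1; apply: equivariant_at; rewrite g1 mul1mx. Qed.

End Equivariant.

Lemma not_boundP : ~ bound_to_collisions m G ->
  exists x v, [/\ H1_loop m x v, equivariant_loops m G x &
                  forall t, ~~ collision (x t)].
Proof.
move=> nb; apply: contrapT => no; apply: nb => x xG.
apply: contrapT => nt; apply: no; have [[v xv] _] := xG.
exists x, v; split=> // t; apply/negP => ct; apply: nt; exists t.
by split=> //; exact: H1_centred xv t.
Qed.

(** The masses as coefficients centre the configuration also when the two bodies
    that are off the origin have different masses. *)
Definition dipole i j (e : 'cV[R]_2) : conf R :=
  fun p => if p == i then m j *: e else if p == j then - (m i *: e) else 0.

Lemma dipole_centred i j e : i != j -> centred m (dipole i j e).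
Proof.
move=> ij; have [k [ki kj _]] := third_body ij.
rewrite /centred (sum3E _ ij ki kj) /dipole !eqxx (negPf ki) (negPf kj).
rewrite eq_sym (negPf ij) scaler0 addr0 scalerN !scalerA mulrC; exact: addrN.
Qed.

Lemma dipole_fixed g i j e : i != j ->
  (sigma G g = 1%g /\ rho G g *m e = e) \/
  (sigma G g = tperm i j /\ rho G g *m e = - e) ->
  conf_act G g (dipole i j e) = dipole i j e.
Proof.
move=> ij h; have [k [ki kj all3]] := third_body ij.
have ji : j == i = false by rewrite eq_sym (negPf ij).
apply: conf_act_fixed => p; case: h => -[sg rg]; rewrite sg.
  rewrite perm1; have [->|->|->] := all3 p;
  by rewrite /dipole ?eqxx ?ji ?(negPf ki) ?(negPf kj) ?mulmxN -?scalemxAr ?rg ?mulmx0.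
have mij : m i = m j by apply: (sigma_mass G_sym (g := g)); rewrite sg tpermL.
have [->|->|->] := all3 p; rewrite ?tpermL ?tpermR ?tpermD 1?eq_sym //;
  by rewrite /dipole ?eqxx ?ji ?(negPf ki) ?(negPf kj) ?mulmxN -?scalemxAr ?rg
    ?mulmx0 ?scalerN ?opprK ?mij.
Qed.

End SymmetryGroupFacts.

(** * Symmetries that act at fixed time *)

Section Core.
Variables (R : realType) (m : 'I_3 -> R) (gT : finGroupType) (G : sym_data R gT).
Hypotheses (G_sym : symmetry_group m G) (G_faithful : trivial_kernel G).
Variables (x0 v0 : R -> conf R).
Hypotheses (x0v0 : H1_loop m x0 v0) (x0G : equivariant_loops m G x0).
Hypothesis x0_free : forall t, ~~ collision (x0 t).
Implicit Types (g h c : gT) (x v : R -> conf R) (s t : R).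

Let free t i j : i != j -> x0 t i != x0 t j.
Proof. exact: collision_freeP _ (x0_free t) i j. Qed.

(** If one body determines the others by similarities that do not depend on the
    loop, every equivariant loop is [x0 0] up to a moving similarity. *)
Lemma homographic_of_base (b : 'I_3) (M : 'I_3 -> 'M[R]_2) :
  (forall p (a d : R), M p *m cmul a d = cmul a d *m M p) ->
  (forall x, equivariant_loops m G x -> forall t p, x t p = M p *m x t b) ->
  homographic m G.
Proof.
move=> Mc xM x xG.
have x00 : x0 0 b != 0.
  have := free 0 (isT : (0 : 'I_3) != 1); apply: contra => /eqP xb.
  by rewrite (xM _ x0G 0 0) (xM _ x0G 0 1) xb !mulmx0.
pose f t := sval (cmul_transitive (x t b) x00).
exists (fun t => (f t).1), (fun t => (f t).2), (x0 0); split.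
  exact: H1_centred x0v0 0.
move=> t p; rewrite (xM _ xG t p) (xM _ x0G 0 p) mulmxA -Mc -mulmxA.
by rewrite /f; case: (cmul_transitive (x t b) x00) => c /= ->.
Qed.

(** A rotation that acts at fixed time either forces a collision or makes the
    triangle of bodies rigid up to similarity: two antipodal bodies and a third
    one at the centre, or an equilateral triangle. *)
Lemma core_rotation g : tau G g = 1%:M -> \det (rho G g) = 1 -> g != 1%g ->
  homographic m G.
Proof.
move=> tg dg g1; have og := rho_orthogonal G_sym g.
have [a _ ea] := orthogonal_det1 og dg.
have core x (xG : equivariant_loops m G x) t i :
    x t (sigma G g i) = rho G g *m x t i by exact: (equivariant_core G_sym).
have rc (q d : R) : rho G g *m cmul q d = cmul q d *m rho G g by rewrite ea cmulC.
have fixed0 x (xG : equivariant_loops m G x) t i : rho G g != 1%:M ->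
    sigma G g i = i -> x t i = 0.
  by move=> r1 si; apply: (rotation_fixed og dg r1); rewrite -core// si.
have [s1|[i [j [ij sij]]]|sN] := perm3P (sigma G g).
- have r1 : rho G g != 1%:M.
    by apply: contra g1 => /eqP r1; apply/eqP; exact: G_faithful.
  have := free 0 (isT : (0 : 'I_3) != 1).
  by rewrite !(fixed0 _ x0G) ?eqxx// s1 perm1.
- have r1 : rho G g != 1%:M.
    apply: contra (free 0 ij) => /eqP r1.
    by rewrite -[x0 0 i]mul1mx -r1 -core// sij tpermL.
  have [k [ki kj all3]] := third_body ij.
  have ji : j == i = false by rewrite eq_sym (negPf ij).
  apply: (@homographic_of_base i (fun p => if p == i then 1%:M else
    if p == j then rho G g else 0)).
    move=> p c d; case: ifP => _; first by rewrite mulmx1 mul1mx.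
    by case: ifP => _ //; rewrite mulmx0 mul0mx.
  move=> x xG t p; have [->|->|->] := all3 p.
  + by rewrite eqxx mul1mx.
  + by rewrite ji eqxx -core// sij tpermL.
  rewrite (negPf ki) (negPf kj) mul0mx (fixed0 _ xG)// sij tpermD//.
    by rewrite eq_sym.
  by rewrite eq_sym.
- have zz := three_cycle_orbit sN; set z := sigma G g in sN core zz *.
  apply: (@homographic_of_base 0 (fun p => if p == 0 then 1%:M else
    if p == z 0 then rho G g else rho G g *m rho G g)).
    move=> p c d; case: ifP => _; first by rewrite mulmx1 mul1mx.
    by case: ifP => _ //; rewrite -mulmxA rc mulmxA rc mulmxA.
  move=> x xG t; apply: (three_cycle_ind sN (i := 0)).
  + by rewrite eqxx mul1mx.
  + by rewrite (negPf (sN _)) eqxx core.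
  by rewrite (negPf (zz _).1) (negPf (sN _)) !core// mulmxA.
Qed.

Hypothesis not_homographic : ~ homographic m G.

Lemma core_rotation1 g : tau G g = 1%:M -> \det (rho G g) = 1 -> g = 1%g.
Proof.
move=> tg dg; apply/eqP; apply: contrapT => /negP g1; apply: not_homographic.
exact: core_rotation tg dg g1.
Qed.

(** The square of such a [g] is a rotation of the core, hence trivial, and [sigma g]
    is an involution. If it were the identity, the reflection [rho g] would
    confine all the bodies to its axis. *)
Lemma core_reflection g : spans_plane m G ->
  tau G g = 1%:M -> \det (rho G g) = -1 ->
  exists i j, i != j /\ sigma G g = tperm i j.
Proof.
move=> spans tg dg.
have gg : (g * g)%g = 1%g.
  apply: core_rotation1; first by rewrite (tau_hom G_sym) tg mulmx1.
  by rewrite (rho_hom G_sym) det_mulmx dg mulrNN mulr1.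
have [s1|//] : sigma G g = 1%g \/ exists i j, i != j /\ sigma G g = tperm i j.
  by apply: involution3P; rewrite -(sigmaM G_sym) gg (sigma1 G_sym).
exfalso; apply: spans.
pose K : {vspace 'cV[R]_2} := lker (linfun (mulmx (rho G g - 1%:M) : _ -> 'cV[R]_2)).
exists K; split.
  apply/eqP => full; have r1 : rho G g = 1%:M.
    apply/eqP; rewrite -subr_eq0; apply/eqP/matrixP => a b.
    have : delta_mx b 0 \in K.
      by rewrite full memvf.
    rewrite memv_ker lfunE /= -colE => /eqP/matrixP/(_ a 0).
    by rewrite !mxE.
  by move: dg; rewrite r1 det1 => /eqP; rewrite -subr_eq0 opprK -(natrD _ 1 1) pnatr_eq0.
move=> x xG t i; rewrite memv_ker lfunE /= mulmxBl mul1mx subr_eq0.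
by rewrite -(equivariant_core G_sym xG)// s1 perm1.
Qed.

(** The configurations fixed by a reflection of the core are isosceles triangles.
    The dipole orthogonal to the axis is fixed by the whole group, up to sign. A
    sign [-1] would make the two symmetric bodies exchange their sides of the axis
    along the loop, so that they would collide in between. *)
Lemma core_reflection_fixed_dipole c i j : tau G c = 1%:M -> \det (rho G c) = -1 ->
  i != j -> sigma G c = tperm i j ->
  exists2 e : 'cV[R]_2, e != 0 &
    forall g, conf_act G g (dipole m i j e) = dipole m i j e.
Proof.
move=> tc dc ij sc; have [k [ki kj all3]] := third_body ij.
have [e [e0 ce anti]] := reflection_axis (rho_orthogonal G_sym c) dc.
exists e => // g; apply: (dipole_fixed G_sym ij).
have cg : (g * c = c * g)%g.
  have cJ : (g * c * g^-1 * c = 1)%g.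
    apply: core_rotation1.
      rewrite !(tau_hom G_sym) tc !mulmx1 -(tau_hom G_sym) mulgV; exact: (tau1 G_sym).
    rewrite !(rho_hom G_sym) !det_mulmx dc mulrN1 mulrN1 mulNr opprK -det_mulmx.
    by rewrite -(rho_hom G_sym) mulgV (rho1 G_sym) det1.
  have cc : (c * c = 1)%g.
    apply: core_rotation1; first by rewrite (tau_hom G_sym) tc mulmx1.
    by rewrite (rho_hom G_sym) det_mulmx dc mulrNN mulr1.
  have cV : (c^-1 = c)%g by apply: (mulIg c); rewrite mulVg cc.
  by move/(congr1 (fun h => h * c^-1 * g)%g): cJ; rewrite mulgK mulgKV mul1g cV.
have ge_anti : rho G c *m (rho G g *m e) = - (rho G g *m e).
  by rewrite mulmxA -(rho_hom G_sym) -cg (rho_hom G_sym) -mulmxA ce mulmxN.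
have ge := anti _ ge_anti; set r := dot e _ in ge.
have dote : dot e e != 0.
  by apply: contra e0 => /eqP de; apply/eqP/sumsq_eq0; rewrite !expr2.
have rr : r = 1 \/ r = -1.
  suff /eqP : r ^+ 2 = 1 by rewrite sqrf_eq1 => /orP[]/eqP; auto.
  apply: (mulIf dote); rewrite mul1r -{2}(orthogonal_dot e e (rho_orthogonal G_sym g)).
  by rewrite ge /dot !mxE; ring.
have sg : sigma G g = 1%g \/ sigma G g = tperm i j.
  by apply: commuting_involution; rewrite // -sc -!(sigmaM G_sym) cg.
pose f t := dot e (x0 t i - x0 t j).
have fE t : x0 t i - x0 t j = f t *: e.
  apply: anti; rewrite mulmxBr -!(equivariant_core G_sym x0G)// sc tpermL tpermR.
  by rewrite opprB.
have fne t : f t != 0.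
  apply: contra (free t ij) => /eqP f0.
  by rewrite -subr_eq0 fE f0 scale0r.
have eI (y z : R) : y *: e = z *: e -> y = z.
  by move=> /eqP; rewrite -subr_eq0 -scalerBl scaler_eq0 (negPf e0) orbF subr_eq0 => /eqP.
have no_change s t : f s <> - f t.
  move=> fst; have [||u fu] := circle_sign_change _ _ fst.
  - rewrite /f /dot => u; apply: cvgD; apply: cvgM; try exact: cvg_cst.
      under eq_fun do rewrite !mxE; rewrite !mxE; exact: (H1_diff_continuous x0v0).
    by under eq_fun do rewrite !mxE; rewrite !mxE; exact: (H1_diff_continuous x0v0).
  - by move=> s' t' st; rewrite /f (H1_circ x0v0 st).
  by have := fne u; rewrite fu eqxx.
have gt0 : circ (time_act (tau G g) 0) = tau G g *m circ 0.
  by rewrite time_actE//; exact: tau_orthogonal G_sym g.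
set t' := time_act _ _ in gt0.
have xt p : x0 t' (sigma G g p) = rho G g *m x0 0 p.
  exact: (equivariant_at G_sym x0G).
have fr : rho G g *m (x0 0 i - x0 0 j) = (f 0 * r) *: e.
  by rewrite fE -scalemxAr ge scalerA.
have [s1|sij] := sg; have [r1|r1] := rr; rewrite r1 in ge fr.
- by left; rewrite s1 ge scale1r.
- exfalso; apply: (no_change t' 0); apply: eI.
  by rewrite -fE -mulrN1 -fr mulmxBr -!xt s1 !perm1.
- exfalso; apply: (no_change t' 0); apply: eI.
  rewrite scaleNr -[f 0]mulr1 -fr mulmxBr -!xt sij tpermL tpermR opprB.
  by rewrite fE.
- by right; rewrite sij ge scaleN1r.
Qed.

End Core.

(** * Time rotations and time reflections *)

Section TimeRotations.
Variables (R : realType) (m : 'I_3 -> R) (gT : finGroupType) (G : sym_data R gT).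
Hypothesis G_sym : symmetry_group m G.
Implicit Types (g h r : gT) (x v : R -> conf R) (s t : R).

Lemma angle_inj (a b : R) : 0 < a <= 2 * pi -> 0 < b <= 2 * pi ->
  rotmx a = rotmx b -> a = b.
Proof.
move=> /andP[a0 a2] /andP[b0 b2] /rotmx_inj/circ_eq[k ab].
have p0 : 0 < 2 * pi :> R by rewrite mulr_gt0// pi_gt0.
have k0 : k = 0.
  apply/eqP; rewrite eq_le; apply/andP; split.
    rewrite leNgt; apply/negP => k1; have : 1 <= k%:~R :> R by rewrite ler1z; lia.
    by move: a2; rewrite ab; nra.
  rewrite leNgt; apply/negP => k1; have : k%:~R <= (-1)%:~R :> R by rewrite ler_int; lia.
  by rewrite rmorphN1; move: a0; rewrite ab; nra.
by rewrite ab k0 mul0r addr0.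
Qed.

Lemma tauX g k : tau G (g ^+ k)%g = tau G g ^+ k.
Proof.
elim: k => [|k IH]; first by rewrite expg0 expr0 (tau1 G_sym).
by rewrite expgS exprS (tau_hom G_sym) IH.
Qed.

Lemma rhoX g k : rho G (g ^+ k)%g = rho G g ^+ k.
Proof.
elim: k => [|k IH]; first by rewrite expg0 expr0 (rho1 G_sym).
by rewrite expgS exprS (rho_hom G_sym) IH.
Qed.

Lemma sigmaX g k : sigma G (g ^+ k)%g = (sigma G g ^+ k)%g.
Proof.
elim: k => [|k IH]; first by rewrite !expg0 (sigma1 G_sym).
by rewrite expgS expgSr (sigmaM G_sym) IH.
Qed.

Section FaithfulTime.
Hypothesis core1 : forall g, tau G g = 1%:M -> g = 1%g.

Lemma tau_inj g h : tau G g = tau G h -> g = h.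
Proof.
move=> gh; apply/eqP; rewrite eq_mulVg1; apply/eqP/core1.
by rewrite (tau_hom G_sym) -gh (tauV G_sym).
Qed.

(** The rotation of least positive angle generates all of them, by Euclidean
    division of angles. *)
Lemma rotation_generator : exists r n, [/\ (0 < n)%N,
  tau G r = rotmx (2 * pi / n%:R) &
  forall g, \det (tau G g) = 1 -> exists k, g = (r ^+ k)%g].
Proof.
have p0 : 0 < 2 * pi :> R by rewrite mulr_gt0// pi_gt0.
have /choice[ang angP] : forall g, exists a, \det (tau G g) = 1 ->
    0 < a <= 2 * pi /\ tau G g = rotmx a.
  move=> g; have [d|d] := eqVneq (\det (tau G g)) 1; last by exists 0 => /eqP; rewrite (negPf d).
  by have [a] := orthogonal_det1 (tau_orthogonal G_sym g) d; exists a.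
pose Gp g := \det (tau G g) == 1.
have Gp1 : Gp 1%g by rewrite /Gp (tau1 G_sym) det1.
case: (@arg_minP _ _ _ 1%g Gp ang Gp1) => r /eqP dr rmin.
have [/andP[r0 r2] er] := angP r dr.
have div g : \det (tau G g) = 1 -> exists k, ang g = ang r * k%:R /\ g = (r ^+ k)%g.
  move=> dg; have [/andP[g0 g2] eg] := angP g dg.
  pose k := Num.truncn (ang g / ang r).
  have /andP[k1 k2] : k%:R <= ang g / ang r < k.+1%:R.
    by apply: truncn_itv; rewrite divr_ge0 ?ltW.
  rewrite ler_pdivlMr// in k1; rewrite ltr_pdivrMr// -natr1 mulrDl mul1r in k2.
  pose h := (g * r ^- k)%g.
  have th : tau G h = rotmx (ang g - k%:R * ang r).
    have rk : tau G (r ^+ k)%g = rotmx (ang r * k%:R) by rewrite tauX er rotmxX.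
    have : tau G h *m tau G (r ^+ k)%g = tau G g by rewrite -(tau_hom G_sym) mulgKV.
    rewrite rk eg => /(congr1 (mulmx^~ (rotmx (- (ang r * k%:R))))).
    by rewrite -mulmxA rotmxKN mulmx1 -rotmxD => ->; congr rotmx; ring.
  have dh : \det (tau G h) = 1 by rewrite th det_rotmx.
  have [ah0|ah0] := eqVneq (ang g - k%:R * ang r) 0; last first.
    have [ah eh] := angP h dh.
    have : ang h = ang g - k%:R * ang r.
      apply: angle_inj; rewrite -?eh ?th//; apply/andP; split; last by lra.
      by rewrite lt_def ah0 subr_ge0.
    have := rmin h; rewrite /Gp dh eqxx => /(_ isT).
    by lra.
  exists k; split; first by lra.
  apply: tau_inj; rewrite tauX er rotmxX eg; congr rotmx; lra.
have [|n [en _]] := div 1%g; first by rewrite (tau1 G_sym) det1.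
have ang1 : ang 1%g = 2 * pi.
  have [|a1 e1] := angP 1%g; first by rewrite (tau1 G_sym) det1.
  apply: angle_inj => //; first by rewrite p0 lexx.
  rewrite -e1 (tau1 G_sym) -rotmx0; apply: rotmx_eq.
  by rewrite -(circ_period 0 1) add0r mul1r.
rewrite ang1 in en; exists r, n; split.
- by rewrite lt0n; apply: contraTneq p0 => n0; rewrite en n0 mulr0 ltxx.
- rewrite er; congr rotmx; rewrite en mulfK// pnatr_eq0; apply: contraTneq p0 => n0.
  by rewrite en n0 mulr0 ltxx.
- by move=> g /div[k [_ gk]]; exists k.
Qed.

End FaithfulTime.

(** If [q] were not [1], every equivariant loop would be a [q]-fold covering. *)
Lemma prime_rotation g (q : nat) : no_common_covering m G -> (0 < q)%N ->
  tau G g = rotmx (2 * pi / q%:R) -> rho G g = 1%:M -> sigma G g = 1%g ->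
  q = 1%N.
Proof.
move=> prime q0 tg rg sg; apply/eqP; apply: contrapT => /negP q1.
apply: prime; exists q%:Z; split; first by apply/eqP => -[] /eqP; apply/negP.
split=> // x xG; have [[v xv] _] := xG.
have per t : x (t + 2 * pi / q%:R) = x t.
  apply/funext => i; have := @equivariant_at _ _ _ _ G_sym x xG g _ t i.
  rewrite sg perm1 rg mul1mx; apply.
  by rewrite tg rotmx_circ addrC.
exists (fun t => x (q%:R^-1 * t)); split.
  by exists (fun t i => q%:R^-1 *: v (q%:R^-1 * t) i); exact: H1_stretch.
by move=> t /=; rewrite mulKf// pnatr_eq0 -lt0n.
Qed.

(** At the two times fixed by a time reflection, the configuration is fixed by
    the space symmetry; if the latter is [1] or [-1] and collisions are excluded,
    either nothing moves or two bodies are exchanged by the antipodal map. *)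
Lemma time_reflection_cases x g : equivariant_loops m G x ->
  (forall t, ~~ collision (x t)) ->
  \det (tau G g) = -1 -> rho G g = 1%:M \/ rho G g = - 1%:M ->
  (sigma G g * sigma G g = 1)%g ->
  (rho G g = 1%:M /\ sigma G g = 1%g) \/
  (rho G g = - 1%:M /\ exists i j, i != j /\ sigma G g = tperm i j).
Proof.
move=> xG nc dg rg ss.
have [a ta] := orthogonal_detN1 (tau_orthogonal G_sym g) dg.
have fixed i : x (a / 2) (sigma G g i) = rho G g *m x (a / 2) i.
  apply: (equivariant_at G_sym xG); rewrite ta -mulmxA reflmx_circ rotmx_circ.
  by congr circ; field.
have free i j : i != j -> x (a / 2) i != x (a / 2) j.
  exact: (collision_freeP _ (nc (a / 2)) i j).
have := involution3P ss.
case=> [s1|[i [j [ij sij]]]]; have [r1|r1] := rg.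
- by left.
- have z i : x (a / 2) i = 0.
    have := fixed i; rewrite s1 perm1 r1 mulNmx mul1mx => /eqP.
    by rewrite -subr_eq0 opprK -mulr2n -scaler_nat scaler_eq0 pnatr_eq0 => /eqP.
  by have := free 0 1 isT; rewrite !z eqxx.
- by have := free i j ij; rewrite -[x _ i]mul1mx -r1 -fixed sij tpermL eqxx.
- by right; split=> //; exists i, j.
Qed.

End TimeRotations.

(** * Conjugation to a model *)

Section Conjugation.
Variable R : realType.
Notation triple := (triple R).
Implicit Types (c d s : triple) (p q : 'S_3) (a b : R) (A B C D : 'M[R]_2).

Definition conj_triple c d : triple := tmul (tmul c d) (tinv c).

Lemma orthogonal_unit A : orthogonal2 A -> A \in unitmx.
Proof. by move=> oA; have [] := mulmx1_unit oA. Qed.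

Lemma orthogonal_invmx A : orthogonal2 A -> invmx A = A^T.
Proof.
move=> oA; have uA := orthogonal_unit oA.
by rewrite -[RHS]mul1mx -(mulVmx uA) -mulmxA oA mulmx1.
Qed.

Let conj_inv (A B C D : 'M[R]_2) : C \in unitmx ->
  A = C *m D *m invmx C -> B *m A = 1%:M -> B = C *m invmx D *m invmx C.
Proof.
move=> uC AE BA; have [uB uA] := mulmx1_unit BA.
have DE : D = invmx C *m A *m C by rewrite AE !mulmxA mulVmx// mul1mx mulmxKV.
have uD : D \in unitmx by rewrite DE !unitmx_mul unitmx_inv uC uA.
have : A *m (C *m invmx D *m invmx C) = 1%:M.
  by rewrite AE -!mulmxA (mulmxA (invmx C)) mulVmx// mul1mx (mulmxA D) mulmxV// mul1mx mulmxV.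
by move=> AB; rewrite -[LHS]mulmx1 -AB mulmxA BA mul1mx.
Qed.

Lemma conj_tripleM c d e : in_O2O2S3 c ->
  conj_triple c (tmul d e) = tmul (conj_triple c d) (conj_triple c e).
Proof.
move=> [/orthogonal_unit u1 /orthogonal_unit u2].
rewrite /conj_triple /tmul /tinv /=; congr (_, _, _); last exact: conjMg.
  by rewrite -!mulmxA (mulmxA (invmx c.1.1)) mulVmx// mul1mx.
by rewrite -!mulmxA (mulmxA (invmx c.1.2)) mulVmx// mul1mx.
Qed.

Lemma conj_triple1 c : in_O2O2S3 c -> conj_triple c (tone R) = tone R.
Proof.
move=> [/orthogonal_unit u1 /orthogonal_unit u2].
by rewrite /conj_triple /tone /tmul /tinv /= !mulmx1 !mulmxV// mul1g mulVg.
Qed.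

(** To conjugate the image of a homomorphism [F] to a model it is enough to
    recognize the generators on both sides. *)
Lemma conjugated_range (gT : finGroupType) (F : gT -> triple) (S : seq triple) c :
  in_O2O2S3 c -> F 1%g = tone R -> (forall g h, F (g * h)%g = tmul (F g) (F h)) ->
  (forall s, s \in S -> exists g, F g = conj_triple c s) ->
  (forall g, exists2 s, generated_by S s & F g = conj_triple c s) ->
  conjugated (range F) (generated_by S).
Proof.
move=> oc F1 FM gens gen; exists c; split=> //; have [oc1 oc2] := oc.
have u1 := orthogonal_unit oc1; have u2 := orthogonal_unit oc2.
apply/seteqP; split=> [_ [g _ <-]|_ [d dS <-]].
  by have [s sS ->] := gen g; exists s.
suff [g gE] : exists g, F g = conj_triple c d by exists g.
elim: dS => {d} [|s|d e _ [g gE] _ [h hE]|d _ [g gE]].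
- by exists 1%g; rewrite F1 conj_triple1.
- exact: gens.
- by exists (g * h)%g; rewrite FM gE hE conj_tripleM.
- exists (g^-1)%g; have : tmul (F g^-1)%g (F g) = tone R by rewrite -FM mulVg.
  move: (F g^-1%g) gE => [[B1 B2] q] ->; rewrite /tmul /tone /= => -[e1 e2 e3].
  rewrite /conj_triple /tmul /tinv /=; congr (_, _, _).
  + exact: conj_inv e1.
  + exact: conj_inv e2.
  + move/eqP: e3; rewrite -eq_invg_mul => /eqP <-; exact: (esym (conjVg _ _)).
Qed.

(** With [g0 = 1] this covers the cyclic groups. *)
Lemma conjugated_range_dihedral (gT : finGroupType) (F : gT -> triple) (S : seq triple) c
    (r g0 : gT) :
  in_O2O2S3 c -> F 1%g = tone R -> (forall g h, F (g * h)%g = tmul (F g) (F h)) ->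
  (forall s, s \in S -> exists g, F g = conj_triple c s) ->
  (forall g, exists k, g = (r ^+ k)%g \/ g = (r ^+ k * g0)%g) ->
  (exists2 s, generated_by S s & F r = conj_triple c s) ->
  (exists2 s, generated_by S s & F g0 = conj_triple c s) ->
  conjugated (range F) (generated_by S).
Proof.
move=> oc F1 FM gens rg [s sS rs] [s0 s0S gs].
have pow k : exists2 d, generated_by S d & F (r ^+ k)%g = conj_triple c d.
  elim: k => [|k [d dS dE]].
    by exists (tone R); [exact: gen_one|rewrite expg0 F1 conj_triple1].
  by exists (tmul s d); [exact: gen_mul|rewrite expgS FM rs dE conj_tripleM].
apply: (@conjugated_range _ F S c) => // g; have [k [->|->]] := rg g; first exact: pow.
have [d dS dE] := pow k; exists (tmul d s0); first exact: gen_mul.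
by rewrite FM dE gs conj_tripleM.
Qed.

Lemma conj_tripleE a b p A B q :
  conj_triple (rotmx a, rotmx b, p) (A, B, q) =
  (rotmx a *m A *m rotmx (- a), rotmx b *m B *m rotmx (- b), (q ^ p)%g).
Proof.
rewrite /conj_triple /tmul /tinv /= !orthogonal_invmx; try exact: orthogonal_rotmx.
by rewrite !tr_rotmx.
Qed.

Lemma rotmxJ a b : rotmx a *m rotmx b *m rotmx (- a) = rotmx b.
Proof. by rewrite -!rotmxD addrAC addrN add0r. Qed.

Lemma oneJ a : rotmx a *m 1%:M *m rotmx (- a) = 1%:M.
Proof. by rewrite mulmx1 rotmxKN. Qed.

Lemma oppJ a : rotmx a *m (- 1%:M) *m rotmx (- a) = - 1%:M.
Proof. by rewrite mulmxN mulNmx oneJ. Qed.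

End Conjugation.

(** * Rotating frames and the quotient by redundant elements *)

Section AngleArithmetic.
Variable R : realType.
Implicit Types (a b s t : R) (A B : 'M[R]_2).

Lemma circ_mulz (z : int) s t : circ s = circ t -> circ (z%:~R * s) = circ (z%:~R * t).
Proof.
move=> /circ_eq[k ->]; rewrite -[RHS](circ_period _ (z * k)); congr circ.
by rewrite intrM; ring.
Qed.

Lemma rotmx_mulz (z : int) s t : circ s = circ t ->
  rotmx (z%:~R * s) = rotmx (z%:~R * t).
Proof. by move=> /(circ_mulz z)/rotmx_eq. Qed.

(** The image of the time [0], which with the determinant determines an
    isometry of the circle. *)
Notation ang A := (time_act A 0).

Lemma circ_ang A : orthogonal2 A -> circ (ang A) = A *m circ 0.
Proof. exact: time_actE. Qed.

Lemma orthogonal_rotE A : orthogonal2 A -> \det A = 1 -> A = rotmx (ang A).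
Proof.
move=> oA dA; have := circ_ang oA; have [a _ ->] := orthogonal_det1 oA dA.
by rewrite rotmx_circ addr0 => /rotmx_eq ->.
Qed.

Lemma orthogonal_reflE A : orthogonal2 A -> \det A = -1 ->
  A = rotmx (ang A) *m reflmx R.
Proof.
move=> oA dA; have := circ_ang oA; have [a ->] := orthogonal_detN1 oA dA.
by rewrite -mulmxA reflmx_circ oppr0 rotmx_circ addr0 => /rotmx_eq ->.
Qed.

Lemma rotation_rotmxC A a : orthogonal2 A -> \det A = 1 ->
  A *m rotmx a = rotmx a *m A.
Proof. by move=> oA dA; rewrite (orthogonal_rotE oA dA) -!rotmxD addrC. Qed.

Lemma reflection_rotmxC A a : orthogonal2 A -> \det A = -1 ->
  A *m rotmx a = rotmx (- a) *m A.
Proof.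
move=> oA dA; rewrite (orthogonal_reflE oA dA) -mulmxA reflmx_rotmx !mulmxA.
by rewrite -!rotmxD addrC.
Qed.

Lemma angM_rotation A B : orthogonal2 A -> orthogonal2 B -> \det A = 1 ->
  circ (ang (A *m B)) = circ (ang A + ang B).
Proof.
move=> oA oB dA; rewrite circ_ang; last exact: orthogonalM.
by rewrite -mulmxA -circ_ang// {1}(orthogonal_rotE oA dA) rotmx_circ.
Qed.

Lemma angM_reflection A B : orthogonal2 A -> orthogonal2 B -> \det A = -1 ->
  circ (ang (A *m B)) = circ (ang A - ang B).
Proof.
move=> oA oB dA; rewrite circ_ang; last exact: orthogonalM.
rewrite -mulmxA -circ_ang// {1}(orthogonal_reflE oA dA) -mulmxA reflmx_circ.
by rewrite rotmx_circ.
Qed.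

(** The isometry induced by [A] through the covering [t |-> k t] of the circle. *)
Definition wind (k : nat) A : 'M[R]_2 :=
  rotmx (k%:R * ang A) *m (if \det A == 1 then 1%:M else reflmx R).

Let neqN11 : -1 == 1 :> R = false.
Proof. by apply/eqP => e; have h : 0 < 1 :> R := ltr01; lra. Qed.

Lemma wind_rotation k A : \det A = 1 -> wind k A = rotmx (k%:R * ang A).
Proof. by rewrite /wind => ->; rewrite eqxx mulmx1. Qed.

Lemma wind_reflection k A : \det A = -1 ->
  wind k A = rotmx (k%:R * ang A) *m reflmx R.
Proof. by rewrite /wind => ->; rewrite neqN11. Qed.

Lemma wind_rotmx k a : wind k (rotmx a) = rotmx (k%:R * a).
Proof.
rewrite wind_rotation ?det_rotmx//; apply: (rotmx_mulz k%:Z).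
by rewrite circ_ang ?rotmx_circ ?addr0//; exact: orthogonal_rotmx.
Qed.

Lemma windM k A B : orthogonal2 A -> orthogonal2 B ->
  wind k (A *m B) = wind k A *m wind k B.
Proof.
move=> oA oB; have [dA|dA] := det_orthogonal oA; have [dB|dB] := det_orthogonal oB.
- rewrite !wind_rotation ?det_mulmx ?dA ?dB ?mulr1//.
  by rewrite (rotmx_mulz k%:Z (angM_rotation oA oB dA)) mulrDr rotmxD.
- rewrite (wind_rotation _ dA) !wind_reflection ?det_mulmx ?dA ?dB ?mul1r//.
  by rewrite (rotmx_mulz k%:Z (angM_rotation oA oB dA)) mulrDr rotmxD mulmxA.
- rewrite (wind_rotation _ dB) !wind_reflection ?det_mulmx ?dA ?dB ?mulr1//.
  rewrite (rotmx_mulz k%:Z (angM_reflection oA oB dA)) mulrBr rotmxD -!mulmxA.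
  by rewrite reflmx_rotmx.
- rewrite wind_rotation ?det_mulmx ?dA ?dB ?mulrNN ?mulr1// !wind_reflection//.
  rewrite (rotmx_mulz k%:Z (angM_reflection oA oB dA)) mulrBr rotmxD.
  by rewrite mulmxA -(mulmxA (rotmx _)) reflmx_rotmx mulmxA -[RHS]mulmxA reflmxK mulmx1.
Qed.

Lemma wind_circ k A s t : orthogonal2 A -> circ s = A *m circ t ->
  circ (k%:R * s) = wind k A *m circ (k%:R * t).
Proof.
move=> oA; have [dA|dA] := det_orthogonal oA.
  rewrite wind_rotation// {1}(orthogonal_rotE oA dA) !rotmx_circ.
  by move=> /(circ_mulz k%:Z); rewrite mulrDr.
rewrite wind_reflection// {1}(orthogonal_reflE oA dA) -!mulmxA !reflmx_circ.
by rewrite !rotmx_circ => /(circ_mulz k%:Z); rewrite mulrBr.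
Qed.

End AngleArithmetic.

Section TypeR.
Variables (R : realType) (m : 'I_3 -> R) (gT : finGroupType) (G : sym_data R gT).
Hypotheses (G_sym : symmetry_group m G) (G_typeR : type_R G).
Implicit Types (g h r : gT).

(** In type R, [rho g] commutes with the rotations of the plane if [tau g] commutes
    with those of the circle, and inverts them if [tau g] does; this is what makes
    the twisted [rho] a homomorphism. *)
Lemma rotate_symmetry_group omega : symmetry_group m (rotate omega G).
Proof.
split=> /=.
- exact: tau_orthogonal G_sym.
- move=> g; apply: orthogonalM; [exact: orthogonal_rotmx|exact: rho_orthogonal G_sym g].
- exact: tau_hom G_sym.
- move=> g h; have og := tau_orthogonal G_sym g; have oh := tau_orthogonal G_sym h.
  have rg := rho_orthogonal G_sym g; have dg := G_typeR g.
  rewrite (rho_hom G_sym) /delta (tau_hom G_sym) !mulmxA.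
  have [d|d] := det_orthogonal og; rewrite d in dg.
    rewrite -[in RHS](mulmxA _ (rho G g)) (rotation_rotmxC _ rg dg) mulmxA -rotmxD.
    congr (_ *m _ *m _); rewrite -!mulNr -mulrDr -!mulrNz.
    by apply: rotmx_mulz; exact: angM_rotation.
  rewrite -[in RHS](mulmxA _ (rho G g)) (reflection_rotmxC _ rg dg) mulmxA -rotmxD.
  congr (_ *m _ *m _); rewrite opprK -!mulNr.
  have -> : - omega%:~R * time_act (tau G g) 0 + omega%:~R * time_act (tau G h) 0
    = (- omega)%:~R * (time_act (tau G g) 0 - time_act (tau G h) 0).
    by rewrite rmorphN /=; ring.
  by rewrite -mulrNz; apply: rotmx_mulz; exact: angM_reflection.
- exact: sigma_hom G_sym.
- exact: sigma_mass G_sym.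
Qed.

Lemma rotate_typeR omega : type_R (rotate omega G).
Proof. by move=> g; rewrite /= det_mulmx det_rotmx mul1r. Qed.

End TypeR.

Section Quotient.
Variables (R : realType) (m : 'I_3 -> R) (gT : finGroupType) (G : sym_data R gT).
Hypotheses (G_sym : symmetry_group m G).
Hypothesis core1 : forall g, tau G g = 1%:M -> g = 1%g.
Implicit Types (g h r : gT).

Definition redundant_set : {set gT} := [set g |
  [&& \det (tau G g) == 1, sigma G g == 1%g & rho G g == 1%:M]]%SET.

Lemma redundant_setE : redundant_set = [set g | (g == 1%g) || redundant G g]%SET.
Proof.
apply/setP => g; rewrite !inE /redundant; have [->|g1] /= := eqVneq g 1%g.
  by rewrite (tau1 G_sym) (sigma1 G_sym) (rho1 G_sym) det1 !eqxx.
rewrite (_ : tau G g != 1%:M)//; apply: contra g1 => /eqP/core1 ->; exact: eqxx.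
Qed.

Lemma redundant_setP g : reflect
  [/\ \det (tau G g) = 1, sigma G g = 1%g & rho G g = 1%:M] (g \in redundant_set).
Proof.
rewrite inE; apply: (iffP and3P); first by case=> /eqP ? /eqP ? /eqP.
by case=> -> -> ->.
Qed.

Lemma redundant_group_set : group_set redundant_set.
Proof.
apply/group_setP; split.
  by apply/redundant_setP; rewrite (tau1 G_sym) (sigma1 G_sym) (rho1 G_sym) det1.
move=> g h /redundant_setP[dg sg rg] /redundant_setP[dh sh rh]; apply/redundant_setP.
rewrite (tau_hom G_sym) (sigmaM G_sym) (rho_hom G_sym) det_mulmx dg dh sg sh rg rh.
by rewrite !mulr1 mulg1 mulmx1.
Qed.

Definition redundant_group : {group gT} := Group redundant_group_set.

Let redundant_norm g : g \in ('N(redundant_group))%g.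
Proof.
rewrite inE; apply/fintype.subsetP => _ /imsetP[h /redundant_setP[dh sh rh] ->]; apply/redundant_setP.
rewrite conjgE !(tau_hom G_sym) !(sigmaM G_sym) !(rho_hom G_sym) sh rh mulg1.
rewrite !det_mulmx dh mul1r -det_mulmx -(tau_hom G_sym) -(sigmaM G_sym).
by rewrite mul1mx -(rho_hom G_sym) mulVg (tau1 G_sym) (sigma1 G_sym) (rho1 G_sym) det1.
Qed.

Definition redundant_proj g : coset_of redundant_group := coset redundant_group g.

Lemma redundant_projM : {in [set: gT]%SET &, {morph redundant_proj : g h / (g * h)%g}}.
Proof. by move=> g h _ _; rewrite /redundant_proj morphM. Qed.

Definition redundant_morphism : {morphism [set: gT]%SET >-> coset_of redundant_group} :=
  Morphism redundant_projM.

Lemma ker_redundant_morphism : ('ker redundant_morphism)%g = redundant_set.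
Proof.
apply/setP => g; transitivity (redundant_proj g == 1%g); first by rewrite !inE.
apply/eqP/idP => [|gH]; last exact: (coset_id (A := redundant_group) gH).
exact: (coset_idr (H := redundant_group)).
Qed.

(** Any representative of a coset gives the same values: [wind] kills the time
    rotations in [redundant_set], whose orders divide its cardinal. *)
Definition quotient_data : sym_data R (coset_of redundant_group) :=
  let rep (C : coset_of redundant_group) := repr C in
  SymData (fun C => wind #|redundant_set| (tau G (rep C))) (fun C => rho G (rep C))
          (fun C => sigma G (rep C)).

Lemma wind_redundant h : h \in redundant_set -> wind #|redundant_set| (tau G h) = 1%:M.
Proof.
move=> hH; have [dh _ _] := redundant_setP _ hH.
have hk : (h ^+ #|redundant_set|)%g = 1%g.
  by apply/eqP; rewrite -order_dvdn; exact: (order_dvdG (G := redundant_group)).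
rewrite wind_rotation// mulrC -rotmxX.
by rewrite -(orthogonal_rotE (tau_orthogonal G_sym h) dh) -(tauX G_sym) hk (tau1 G_sym).
Qed.

Lemma quotient_dataE g :
  [/\ tau quotient_data (redundant_proj g) = wind #|redundant_set| (tau G g),
      rho quotient_data (redundant_proj g) = rho G g &
      sigma quotient_data (redundant_proj g) = sigma G g].
Proof.
have /rcosetP[h hH eg] : repr (redundant_proj g) \in (redundant_group :* g)%g.
  by rewrite -val_coset ?mem_repr_coset.
have [dh sh rh] := redundant_setP _ hH; rewrite /= eg; split.
- rewrite (tau_hom G_sym) windM; try exact: tau_orthogonal G_sym _.
  by rewrite wind_redundant// mul1mx.
- by rewrite (rho_hom G_sym) rh mul1mx.
- by rewrite (sigmaM G_sym) sh mulg1.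
Qed.

Definition quotient_triple g : triple R :=
  (wind #|redundant_set| (tau G g), rho G g, sigma G g).

Lemma image_quotient_data : image_group quotient_data = range quotient_triple.
Proof.
apply/seteqP; split=> [_ [C _ <-]|_ [g _ <-]].
  exists (repr C) => //.
exists (redundant_proj g) => //; have [-> -> ->] := quotient_dataE g.
by [].
Qed.

Lemma quotient_by_redundantP : quotient_by_redundant G quotient_data.
Proof.
exists redundant_morphism; split.
- by move=> C; exists (repr C); exact: coset_reprK.
- by rewrite ker_redundant_morphism redundant_setE.
- by move=> g; have [] := quotient_dataE g.
- by move=> g; have [] := quotient_dataE g.
- move=> g t s /(wind_circ #|redundant_set| (tau_orthogonal G_sym g)).
  by rewrite ker_redundant_morphism; have [<- _ _] := quotient_dataE g.
Qed.

End Quotient.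

Section Models.
Variables (R : realType) (gT : finGroupType) (F : gT -> triple R).
Hypotheses (F1 : F 1%g = tone R)
  (FM : forall g h, F (g * h)%g = tmul (F g) (F h)).
Implicit Types (g h r : gT) (z t p : 'S_3) (a b : R).

Lemma rotmx2pi : rotmx (2 * pi) = 1%:M :> 'M[R]_2.
Proof.
by rewrite -rotmx0; apply: rotmx_eq; rewrite -(circ_period 0 1) add0r mul1r.
Qed.

Let in_frame a b p : in_O2O2S3 (rotmx a, rotmx b, p).
Proof. by split; exact: orthogonal_rotmx. Qed.

Lemma cyclic_model r z :
  (forall g, exists k, g = (r ^+ k)%g) ->
  F r = (rotmx (2 * pi / #[z]%g%:R), 1%:M, z) ->
  exists L, conjugated (range F) (@model_group R L).
Proof.
move=> gen Fr.
have gen2 g : exists k, g = (r ^+ k)%g \/ g = (r ^+ k * 1)%g.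
  by have [k gk] := gen g; exists k; left.
have F1c c : in_O2O2S3 c -> F 1%g = conj_triple c (tone R).
  by move=> oc; rewrite F1 conj_triple1.
have [z1|[i [j [ij zij]]]|zN] := perm3P z.
- exists Trivial.
  apply: (@conjugated_range_dihedral _ _ _ _ (rotmx 0, rotmx 0, 1%g) r 1%g) => //.
    exists (tone R); first exact: gen_one.
    by rewrite conj_triple1// Fr z1 order1 divr1 rotmx2pi.
  by exists (tone R); [exact: gen_one|exact: F1c].
- have [c3 ec3] := transp12_conj ij; exists Choreography21.
  have Fr' : F r = conj_triple (rotmx 0, rotmx 0, c3) (rotmx pi, 1%:M, transp12).
    rewrite conj_tripleE rotmxJ oneJ ec3 Fr zij; congr (rotmx _, _, _).
    by rewrite tperm_order//; field.
  apply: (@conjugated_range_dihedral _ _ _ _ (rotmx 0, rotmx 0, c3) r 1%g) => //.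
  + by move=> s; rewrite mem_seq1 => /eqP ->; exists r.
  + by exists (rotmx pi, 1%:M, transp12) => //; apply: gen_in; rewrite mem_seq1.
  + by exists (tone R); [exact: gen_one|exact: F1c].
- have [c3 [_ ec3]] := three_cycle_frame zN 0; exists Choreography3.
  have oz := three_cycle_order zN.
  have Fr' : F r = conj_triple (rotmx 0, rotmx 0, c3) (rotmx (2 * pi / 3), 1%:M, cycle123).
    by rewrite conj_tripleE rotmxJ oneJ ec3 Fr oz.
  apply: (@conjugated_range_dihedral _ _ _ _ (rotmx 0, rotmx 0, c3) r 1%g) => //.
  + by move=> s; rewrite mem_seq1 => /eqP ->; exists r.
  + by exists (rotmx (2 * pi / 3), 1%:M, cycle123) => //; apply: gen_in; rewrite mem_seq1.
  + by exists (tone R); [exact: gen_one|exact: F1c].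
Qed.

(** The rotations by [a / 2] and [b / 2] turn the axes of [g0] to those of the models
    and commute with the rotation of [r]; a relabelling of the bodies does the
    rest. *)
Lemma dihedral_model r g0 z t a b :
  (forall g, exists k, g = (r ^+ k)%g \/ g = (r ^+ k * g0)%g) ->
  F r = (rotmx (2 * pi / #[z]%g%:R), 1%:M, z) ->
  F g0 = (rotmx a *m reflmx R, rotmx b *m reflmx R, t) ->
  (t * t = 1)%g -> (t * z * t = z^-1)%g ->
  exists L, conjugated (range F) (@model_group R L).
Proof.
move=> gen Fr Fg tt tz.
have gE a' b' p q : (rotmx a' *m reflmx R, rotmx b' *m reflmx R, (q ^ p)%g) =
    conj_triple (rotmx (a' / 2), rotmx (b' / 2), p) (reflmx R, reflmx R, q).
  by rewrite conj_tripleE -!reflection_conj.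
have [z1|[i [j [ij zij]]]|zN] := perm3P z.
- have Fr' : F r = tone R by rewrite Fr z1 order1 divr1 rotmx2pi.
  have trivial_r c S : in_O2O2S3 c -> exists2 s, generated_by S s & F r = conj_triple c s.
    by move=> oc; exists (tone R); [exact: gen_one|rewrite Fr' conj_triple1].
  have [t1|[i [j [ij tij]]]] := involution3P tt.
    exists Line.
    have Fg' : F g0 = conj_triple (rotmx (a / 2), rotmx (b / 2), 1%g) (reflmx R, reflmx R, 1%g).
      by rewrite -gE Fg t1 conj1g.
    apply: (@conjugated_range_dihedral _ _ _ _ (rotmx (a / 2), rotmx (b / 2), 1%g) r g0) => //.
    + by move=> s; rewrite mem_seq1 => /eqP ->; exists g0.
    + exact: trivial_r.
    + by exists (reflmx R, reflmx R, 1%g) => //; apply: gen_in; rewrite mem_seq1.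
  have [c3 ec3] := transp12_conj ij; exists Isosceles.
  have Fg' : F g0 = conj_triple (rotmx (a / 2), rotmx (b / 2), c3) (reflmx R, reflmx R, transp12).
    by rewrite -gE Fg tij ec3.
  apply: (@conjugated_range_dihedral _ _ _ _ (rotmx (a / 2), rotmx (b / 2), c3) r g0) => //.
  + by move=> s; rewrite mem_seq1 => /eqP ->; exists g0.
  + exact: trivial_r.
  + by exists (reflmx R, reflmx R, transp12) => //; apply: gen_in; rewrite mem_seq1.
- have pi2 : 2 * pi / 2 = pi :> R by field.
  rewrite [in #[z]%g]zij tperm_order// pi2 in Fr.
  have [c3 ec3] := transp12_conj ij; exists Hill.
  (* one of the two reflections, [g0] or [r * g0], does not permute the bodies *)
  have [g1 [a' [gen1 Fg1]]] : exists g1 a',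
      (forall g, exists k, g = (r ^+ k)%g \/ g = (r ^+ k * g1)%g) /\
      F g1 = (rotmx a' *m reflmx R, rotmx b *m reflmx R, 1%g).
    have [t1|tij] : t = 1%g \/ t = tperm i j.
      by apply: inverting_involution_transp; rewrite // -zij.
      by exists g0, a; split=> //; rewrite Fg t1.
    exists (r * g0)%g, (pi + a); split.
      move=> g; have [k [gk|gk]] := gen g; first by exists k; left.
      exists (k + #[r]%g.-1)%N; right; rewrite gk mulgA expgD; congr (_ * _)%g.
      by rewrite -mulgA -expgSr prednK ?order_gt0// expg_order mulg1.
    by rewrite FM Fr Fg /tmul /= mulmxA -rotmxD mul1mx tij zij tperm2.
  have Fr' : F r = conj_triple (rotmx (a' / 2), rotmx (b / 2), c3) (rotmx pi, 1%:M, transp12).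
    by rewrite conj_tripleE rotmxJ oneJ ec3 Fr zij.
  have Fg' : F g1 = conj_triple (rotmx (a' / 2), rotmx (b / 2), c3) (reflmx R, reflmx R, 1%g).
    by rewrite -gE Fg1 conj1g.
  apply: (@conjugated_range_dihedral _ _ _ _ (rotmx (a' / 2), rotmx (b / 2), c3) r g1) => //.
  + by move=> s; rewrite !inE => /orP[]/eqP ->; [exists r|exists g1].
  + exists (rotmx pi, 1%:M, transp12) => //; apply: gen_in; exact: mem_head.
  + exists (reflmx R, reflmx R, 1%g) => //; apply: gen_in; by rewrite !inE eqxx orbT.
- rewrite (three_cycle_order zN) in Fr.
  have [i [j [ij tij]]] := inverting_involution zN tt tz.
  have [c3 [ec3 ec3']] := three_cycle_frame_transp zN ij; exists Defs.Lagrange.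
  have Fr' : F r = conj_triple (rotmx (a / 2), rotmx (b / 2), c3)
      (rotmx (2 * pi / 3), 1%:M, cycle123).
    by rewrite conj_tripleE rotmxJ oneJ ec3' Fr.
  have Fg' : F g0 = conj_triple (rotmx (a / 2), rotmx (b / 2), c3) (reflmx R, reflmx R, transp12).
    by rewrite -gE Fg tij ec3.
  apply: (@conjugated_range_dihedral _ _ _ _ (rotmx (a / 2), rotmx (b / 2), c3) r g0) => //.
  + by move=> s; rewrite !inE => /orP[]/eqP ->; [exists r|exists g0].
  + exists (rotmx (2 * pi / 3), 1%:M, cycle123) => //; apply: gen_in; exact: mem_head.
  + exists (reflmx R, reflmx R, transp12) => //; apply: gen_in; by rewrite !inE eqxx orbT.
Qed.

Lemma C6_model r z b : (forall i, z i != i) ->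
  (forall g, exists k, g = (r ^+ k)%g) ->
  F r = (rotmx (pi / 3), rotmx b *m reflmx R, z) ->
  conjugated (range F) (@model_group R C6).
Proof.
move=> zN gen Fr; have [c3 [_ ec3]] := three_cycle_frame zN 0.
have gen2 g : exists k, g = (r ^+ k)%g \/ g = (r ^+ k * 1)%g.
  by have [k gk] := gen g; exists k; left.
have Fr' : F r = conj_triple (rotmx 0, rotmx (b / 2), c3)
    (rotmx (pi / 3), reflmx R, cycle123).
  by rewrite conj_tripleE rotmxJ -reflection_conj ec3 Fr.
apply: (@conjugated_range_dihedral _ _ _ _ (rotmx 0, rotmx (b / 2), c3) r 1%g) => //.
- by move=> s; rewrite mem_seq1 => /eqP ->; exists r.
- by exists (rotmx (pi / 3), reflmx R, cycle123) => //; apply: gen_in; rewrite mem_seq1.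
- by exists (tone R); [exact: gen_one|rewrite F1 conj_triple1].
Qed.

Lemma D12_model r g0 z a b i j : (forall i, z i != i) -> i != j ->
  (forall g, exists k, g = (r ^+ k)%g \/ g = (r ^+ k * g0)%g) ->
  F r = (rotmx (pi / 3), rotmx b *m reflmx R, z) ->
  F g0 = (rotmx a *m reflmx R, - 1%:M, tperm i j) ->
  conjugated (range F) (@model_group R D12).
Proof.
move=> zN ij gen Fr Fg; have [c3 [ec3 ec3']] := three_cycle_frame_transp zN ij.
have Fr' : F r = conj_triple (rotmx (a / 2), rotmx (b / 2), c3)
    (rotmx (pi / 3), reflmx R, cycle123).
  by rewrite conj_tripleE rotmxJ -reflection_conj ec3' Fr.
have Fg' : F g0 = conj_triple (rotmx (a / 2), rotmx (b / 2), c3)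
    (reflmx R, - 1%:M, transp12).
  by rewrite conj_tripleE oppJ -reflection_conj ec3 Fg.
apply: (@conjugated_range_dihedral _ _ _ _ (rotmx (a / 2), rotmx (b / 2), c3) r g0) => //.
- by move=> s; rewrite !inE => /orP[]/eqP ->; [exists r|exists g0].
- exists (rotmx (pi / 3), reflmx R, cycle123) => //; apply: gen_in; exact: mem_head.
- exists (reflmx R, - 1%:M, transp12) => //; apply: gen_in; by rewrite !inE eqxx orbT.
Qed.

Lemma D6_model r g0 z a i j : (forall i, z i != i) -> i != j ->
  (forall g, exists k, g = (r ^+ k)%g \/ g = (r ^+ k * g0)%g) ->
  F r = (rotmx (2 * pi / 3), 1%:M, z) ->
  F g0 = (rotmx a *m reflmx R, - 1%:M, tperm i j) ->
  conjugated (range F) (@model_group R D6).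
Proof.
move=> zN ij gen Fr Fg.
(* the second generator of the model is a square, whose permutation is the
   inverse of the given 3-cycle *)
have zVN (q : 'I_3) : (z^-1)%g q != q.
  by rewrite -(inj_eq (@perm_inj _ z)) permKV eq_sym zN.
have [c3 [ec3 ec3']] := three_cycle_frame_transp zVN ij.
have sqr : ((cycle123 * cycle123) ^ c3)%g = z.
  rewrite conjMg ec3' -invMg; apply: (mulgI (z * z)%g).
  by rewrite mulgV three_cycle_cube.
pose c6 : triple R := (rotmx (pi / 3), reflmx R, cycle123).
have c6E : tmul c6 c6 = (rotmx (2 * pi / 3), 1%:M, (cycle123 * cycle123)%g).
  by rewrite /tmul /= -rotmxD reflmxK; congr (rotmx _, _, _); field.
have Fr' : F r = conj_triple (rotmx (a / 2), rotmx 0, c3) (tmul c6 c6).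
  by rewrite c6E conj_tripleE rotmxJ oneJ sqr Fr.
have Fg' : F g0 = conj_triple (rotmx (a / 2), rotmx 0, c3)
    (reflmx R, - 1%:M, transp12).
  by rewrite conj_tripleE oppJ -reflection_conj ec3 Fg.
apply: (@conjugated_range_dihedral _ _ _ _ (rotmx (a / 2), rotmx 0, c3) r g0) => //.
- by move=> s; rewrite !inE => /orP[]/eqP ->; [exists g0|exists r].
- by exists (tmul c6 c6) => //; apply: gen_in; rewrite !inE eqxx orbT.
- exists (reflmx R, - 1%:M, transp12) => //; apply: gen_in; exact: mem_head.
Qed.

End Models.

(** * Groups of type R *)

Section Classification.
Variables (R : realType) (m : 'I_3 -> R) (gT : finGroupType) (G : sym_data R gT).
Hypothesis G_sym : symmetry_group m G.
Hypothesis core1 : forall g, tau G g = 1%:M -> g = 1%g.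
Implicit Types (g h r : gT).

Lemma time_reflection_invol g : \det (tau G g) = -1 -> (g * g = 1)%g.
Proof.
move=> dg; apply: core1; rewrite (tau_hom G_sym).
by have [a ->] := orthogonal_detN1 (tau_orthogonal G_sym g) dg; exact: reflection_invol.
Qed.

Lemma sigma_reflection_invol g : \det (tau G g) = -1 ->
  (sigma G g * sigma G g = 1)%g.
Proof.
by move=> dg; rewrite -(sigmaM G_sym) time_reflection_invol// (sigma1 G_sym).
Qed.

Lemma sigma_reflection_inverts g r : \det (tau G g) = -1 -> \det (tau G r) = 1 ->
  (sigma G g * sigma G r * sigma G g = (sigma G r)^-1)%g.
Proof.
move=> dg dr.
have : (g * r * (g * r) = 1)%g.
  by apply: time_reflection_invol; rewrite (tau_hom G_sym) det_mulmx dg dr mulr1.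
move/(congr1 (sigma G)); rewrite !(sigmaM G_sym) (sigma1 G_sym) => e.
by apply: (mulgI (sigma G r)); rewrite mulgV -e !mulgA.
Qed.

Section Generator.
Variables (r : gT) (n : nat).
Hypotheses (n_gt0 : (0 < n)%N) (tr : tau G r = rotmx (2 * pi / n%:R))
  (gen : forall g, \det (tau G g) = 1 -> exists k, g = (r ^+ k)%g).

Let n0 : n%:R != 0 :> R.
Proof. by rewrite pnatr_eq0 -lt0n. Qed.

Lemma tau_generatorX k : tau G (r ^+ k)%g = rotmx (2 * pi * (k%:R / n%:R)).
Proof. by rewrite (tauX G_sym) tr rotmxX; congr rotmx; field. Qed.

Lemma generator_order : #[r]%g = n.
Proof.
apply/eqP; rewrite eqn_dvd order_dvdn; apply/andP; split.
  by apply/eqP/core1; rewrite tau_generatorX divff// mulr1 rotmx2pi.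
have : tau G (r ^+ #[r])%g = rotmx 0.
  by rewrite expg_order (tau1 G_sym) rotmx0.
rewrite tau_generatorX => /rotmx_inj/circ_eq[k]; rewrite add0r.
have p0 : 2 * pi != 0 :> R by rewrite mulf_neq0// gt_eqF ?pi_gt0.
rewrite mulrC => /(mulIf p0)/(congr1 ( *%R^~ n%:R)); rewrite mulfVK// => e.
have : (#[r]%g%:Z = k * n%:Z)%R by apply: (@intr_inj R); rewrite intrM.
move=> {}e; have k0 : 0 <= k by rewrite -(pmulr_lge0 _ (_ : 0 < n%:Z))// -e.
by case: k k0 e => // k _ [->]; exact: dvdn_mull.
Qed.

(** When [rho] is trivial on time rotations, the redundant ones are those
    that do not permute the bodies. *)
Lemma card_redundant_set : (forall g, \det (tau G g) = 1 -> rho G g = 1%:M) ->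
  #|redundant_set G| = (n %/ #[sigma G r]%g)%N.
Proof.
move=> rho_triv; set o := #[sigma G r]%g.
have on : (o %| #[r]%g)%N.
  by rewrite order_dvdn -(sigmaX G_sym) expg_order (sigma1 G_sym).
rewrite -generator_order -(orderXdiv on) orderE; congr #|pred_of_set _|.
apply/setP => g; apply/redundant_setP/cycleP => [[dg sg _]|[k ->]].
  have [k gk] := gen dg; rewrite gk in sg *.
  have /dvdnP[q ->] : (o %| k)%N by rewrite order_dvdn -(sigmaX G_sym) sg.
  by exists q; rewrite -expgM mulnC.
have d : \det (tau G ((r ^+ o) ^+ k)%g) = 1 by rewrite -expgM tau_generatorX det_rotmx.
by split=> //; [rewrite !(sigmaX G_sym) expg_order expg1n|exact: rho_triv].
Qed.

Lemma generator_reflection g0 : \det (tau G g0) = -1 ->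
  forall g, exists k, g = (r ^+ k)%g \/ g = (r ^+ k * g0)%g.
Proof.
move=> d0 g; have [d|d] := det_orthogonal (tau_orthogonal G_sym g).
  by have [k ->] := gen d; exists k; left.
have [k gk] : exists k, (g * g0)%g = (r ^+ k)%g.
  by apply: gen; rewrite (tau_hom G_sym) det_mulmx d d0 mulrNN mulr1.
by exists k; right; rewrite -gk -mulgA time_reflection_invol// mulg1.
Qed.

End Generator.

Section RotatedTypeR.
Hypothesis G_typeR : type_R G.
Hypothesis rho_triv : forall g, \det (tau G g) = 1 -> rho G g = 1%:M.

(** In the quotient the generator turns time by [2 * pi] over the order of the
    permutation of the bodies that it induces, which is [1], [2] or [3]. *)
Lemma quotient_model : exists L, conjugated (image_group (quotient_data G_sym)) (@model_group R L).
Proof.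
have [r [n [n0 tr gen]]] := rotation_generator G_sym core1.
rewrite image_quotient_data.
have F1 : quotient_triple G 1%g = tone R.
  rewrite /quotient_triple (tau1 G_sym) (rho1 G_sym) (sigma1 G_sym).
  by rewrite -{1}rotmx0 wind_rotmx mulr0 rotmx0.
have FM g h : quotient_triple G (g * h)%g =
    tmul (quotient_triple G g) (quotient_triple G h).
  rewrite /quotient_triple (tau_hom G_sym) (rho_hom G_sym) (sigmaM G_sym).
  by rewrite windM//; exact: tau_orthogonal G_sym _.
have on : (#[sigma G r]%g %| n)%N.
  rewrite -(generator_order n0 tr) order_dvdn -(sigmaX G_sym) expg_order.
  by rewrite (sigma1 G_sym).
have dr : \det (tau G r) = 1 by rewrite tr det_rotmx.
have Fr : quotient_triple G r = (rotmx (2 * pi / #[sigma G r]%g%:R), 1%:M, sigma G r).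
  rewrite /quotient_triple (rho_triv dr) (card_redundant_set n0 tr gen rho_triv) tr wind_rotmx.
  congr (rotmx _, _, _); have /dvdnP[q nq] := on.
  have o0 := order_gt0 (sigma G r); rewrite nq mulnK// natrM.
  have o1 : #[sigma G r]%g%:R != 0 :> R by rewrite pnatr_eq0 -lt0n.
  have q1 : q%:R != 0 :> R.
    by rewrite pnatr_eq0; apply: contraTneq n0 => q0; rewrite nq q0.
  by field; rewrite o1.
have [[g0 d0]|no_refl] := pselect (exists g0, \det (tau G g0) = -1).
  have dr0 : \det (rho G g0) = -1 by rewrite G_typeR.
  have [b eb] := orthogonal_detN1 (rho_orthogonal G_sym g0) dr0.
  apply: (dihedral_model F1 FM (generator_reflection gen d0) Fr _
    (sigma_reflection_invol d0) (sigma_reflection_inverts d0 dr)).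
  by rewrite /quotient_triple (wind_reflection _ d0) eb.
apply: (cyclic_model F1 FM _ Fr) => g; apply: gen.
have [//|d] := det_orthogonal (tau_orthogonal G_sym g).
by case: no_refl; exists g.
Qed.

End RotatedTypeR.

End Classification.

(** As [r ^+ n = 1], the rotation [rho r] has an angle [b] such that [b * n] is [k]
    turns for an integer [k], and the frame of angular velocity [k] stops it. *)
Lemma type_R_model (R : realType) (m : 'I_3 -> R) (gT : finGroupType)
    (G : sym_data R gT) :
  symmetry_group m G -> (forall g, tau G g = 1%:M -> g = 1%g) -> type_R G ->
  exists L, conjugated_up_to_frame G L.
Proof.
move=> G_sym core1 G_typeR.
have [r [n [n0 tr gen]]] := rotation_generator G_sym core1.
have nn : n%:R != 0 :> R by rewrite pnatr_eq0 -lt0n.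
have dr : \det (tau G r) = 1 by rewrite tr det_rotmx.
have [b _ rb] := orthogonal_det1 (rho_orthogonal G_sym r) (etrans (G_typeR r) dr).
have [k bk] : exists k : int, b * n%:R = 0 + k%:~R * (2 * pi).
  apply: circ_eq; apply: rotmx_inj.
  rewrite -rotmxX -rb -(rhoX G_sym) -(generator_order G_sym core1 n0 tr) expg_order.
  by rewrite (rho1 G_sym) rotmx0.
have Gr_sym := rotate_symmetry_group G_sym G_typeR k.
have Gr_core1 : forall g, tau (rotate k G) g = 1%:M -> g = 1%g by [].
have rr : rho (rotate k G) r = 1%:M.
  rewrite /= rb /delta -mulNr -rmorphN /= (@rotmx_mulz _ (- k) _ (2 * pi / n%:R)).
    rewrite -rotmxD -rotmx0; congr rotmx; rewrite rmorphN /=.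
    by rewrite (_ : b = k%:~R * (2 * pi) / n%:R) ?mulfK//; [field|rewrite -[k%:~R * _]add0r -bk mulfK].
  by rewrite circ_ang ?tr ?rotmx_circ ?addr0//; exact: orthogonal_rotmx.
have rho_triv g : \det (tau (rotate k G) g) = 1 -> rho (rotate k G) g = 1%:M.
  by move=> /gen[q ->]; rewrite (rhoX Gr_sym) rr expr1n.
have [L conjL] := quotient_model Gr_sym Gr_core1 (rotate_typeR G_typeR k) rho_triv.
exists L; right; split=> //; exists k; eexists; exists (quotient_data Gr_sym).
by split=> //; exact: quotient_by_redundantP Gr_core1.
Qed.

(** * Groups not of type R *)

Section NotTypeR.
Variables (R : realType) (m : 'I_3 -> R) (gT : finGroupType) (G : sym_data R gT).
Hypotheses (G_sym : symmetry_group m G).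
Hypothesis core1 : forall g, tau G g = 1%:M -> g = 1%g.
Hypothesis prime : no_common_covering m G.
Variable x0 : R -> conf R.
Hypotheses (x0G : equivariant_loops m G x0) (x0_free : forall t, ~~ collision (x0 t)).
Hypothesis no_fixed_dipole : forall i j (e : 'cV[R]_2), i != j -> e != 0 ->
  ~ (forall g, conf_act G g (dipole m i j e) = dipole m i j e).
Implicit Types (g h : gT).

Variables (r : gT) (n : nat).
Hypotheses (n_gt0 : (0 < n)%N) (tr : tau G r = rotmx (2 * pi / n%:R))
  (gen : forall g, \det (tau G g) = 1 -> exists k, g = (r ^+ k)%g).

Let dr : \det (tau G r) = 1.
Proof. by rewrite tr det_rotmx. Qed.

Let z := sigma G r.

(** Time reflections are involutions, because [tau] is injective; hence one that
    acts on the plane by a rotation acts by [1] or [-1]. *)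
Let reflection_cases g : \det (tau G g) = -1 -> \det (rho G g) = 1 ->
  (rho G g = 1%:M /\ sigma G g = 1%g) \/
  (rho G g = - 1%:M /\ exists i j, i != j /\ sigma G g = tperm i j).
Proof.
move=> dt dg; apply: (time_reflection_cases G_sym x0G x0_free dt).
  apply: (rotation_invol (rho_orthogonal G_sym g) dg).
  by rewrite -(rho_hom G_sym) (time_reflection_invol G_sym core1 dt) (rho1 G_sym).
exact: (sigma_reflection_invol G_sym core1 dt).
Qed.

Let dipole_fixed_pow i j e k :
  conf_act G r (dipole m i j e) = dipole m i j e ->
  conf_act G (r ^+ k)%g (dipole m i j e) = dipole m i j e.
Proof.
move=> fr; elim: k => [|k IH]; last by rewrite expgS (conf_actM G_sym) IH.
apply: (conf_act_fixed G_sym) => p.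
by rewrite expg0 (sigma1 G_sym) perm1 (rho1 G_sym) mul1mx.
Qed.

Let sigma_pair g : \det (tau G g) = -1 -> ~ (forall i, z i != i) ->
  exists i j, [/\ i != j, z = 1%g \/ z = tperm i j &
                  sigma G g = 1%g \/ sigma G g = tperm i j].
Proof.
move=> dg zN; have tt := sigma_reflection_invol G_sym core1 dg.
have tz := sigma_reflection_inverts G_sym core1 dg dr; rewrite -/z in tz.
have [z1|[i [j [ij zij]]]|//] := perm3P z.
  have [t1|[i [j [ij tij]]]] := involution3P tt.
    by exists 0, 1; split=> //; left.
  by exists i, j; split=> //; [left|right].
exists i, j; split=> //; first by right.
by apply: inverting_involution_transp; rewrite // -zij.
Qed.

Let reflection_fixes_dipole g i j e : \det (tau G g) = -1 -> \det (rho G g) = 1 ->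
  i != j -> sigma G g = 1%g \/ sigma G g = tperm i j ->
  conf_act G g (dipole m i j e) = dipole m i j e.
Proof.
move=> dt dg ij sg; apply: (dipole_fixed G_sym ij).
have [[-> s1]|[-> [p [q [pq spq]]]]] := reflection_cases dt dg.
  by left; rewrite mul1mx.
right; rewrite mulNmx mul1mx; split=> //; case: sg => [s1|//].
by move: pq; rewrite -(tpermL p q) -spq s1 perm1 eqxx.
Qed.

Let axis_exists i j : i != j -> \det (rho G r) = -1 -> z = 1%g \/ z = tperm i j ->
  exists2 e : 'cV[R]_2, e != 0 & conf_act G r (dipole m i j e) = dipole m i j e.
Proof.
move=> ij drho zij; have orho := rho_orthogonal G_sym r; case: zij => zij.
  have [||e [e0 ee _]] := @reflection_axis _ (- rho G r).
  - by rewrite /orthogonal2 linearN /= mulmxN mulNmx opprK.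
  - by rewrite -drho !det2E !mxE; ring.
  exists e => //; apply: (dipole_fixed G_sym ij); left; split=> //.
  by apply: oppr_inj; rewrite -mulNmx.
have [e [e0 ee _]] := reflection_axis orho drho.
by exists e => //; apply: (dipole_fixed G_sym ij); right.
Qed.

Let z3 : (forall i, z i != i) -> (z ^+ 3 = 1)%g.
Proof. by move=> zN; have := expg_order z; rewrite three_cycle_order. Qed.

Let dvd3n : (forall i, z i != i) -> (3 %| n)%N.
Proof.
move=> zN; rewrite -(three_cycle_order zN) order_dvdn -(sigmaX G_sym).
by rewrite -(generator_order G_sym core1 n_gt0 tr) expg_order (sigma1 G_sym).
Qed.

Let F g : triple R := (tau G g, rho G g, sigma G g).

Let F1 : F 1%g = tone R.
Proof. by rewrite /F (tau1 G_sym) (rho1 G_sym) (sigma1 G_sym). Qed.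

Let FM g h : F (g * h)%g = tmul (F g) (F h).
Proof. by rewrite /F (tau_hom G_sym) (rho_hom G_sym) (sigmaM G_sym). Qed.

Let n_minimal d : (0 < d)%N -> (d %| n)%N -> rho G (r ^+ d)%g = 1%:M ->
  sigma G (r ^+ d)%g = 1%g -> n = d.
Proof.
move=> d0 /dvdnP[q nq] rd sd.
have q0 : (0 < q)%N by move: n_gt0; rewrite nq muln_gt0 => /andP[].
have q1 : q = 1%N; last by rewrite nq q1 mul1n.
apply: (prime_rotation G_sym prime q0 _ rd sd).
rewrite (tau_generatorX G_sym n_gt0 tr) nq natrM; congr rotmx.
have qn : q%:R != 0 :> R by rewrite pnatr_eq0 -lt0n.
have dn : d%:R != 0 :> R by rewrite pnatr_eq0 -lt0n.
by field; rewrite qn.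
Qed.

Let det_rhoX k : \det (rho G (r ^+ k)%g) = \det (rho G r) ^+ k.
Proof.
elim: k => [|k IH]; first by rewrite expg0 (rho1 G_sym) det1 expr0.
by rewrite expgS (rho_hom G_sym) det_mulmx IH exprS.
Qed.

Let circ0_neq0 : (circ 0 : 'cV[R]_2) != 0.
Proof. by apply/eqP => /colP/(_ 0)/eqP; rewrite circE cos0 mxE oner_eq0. Qed.

Let inverting_moves g : \det (tau G g) = -1 -> (forall p, z p != p) ->
  sigma G g != 1%g.
Proof.
move=> dt zN.
have [i [j [ij ->]]] := inverting_involution zN
  (sigma_reflection_invol G_sym core1 dt) (sigma_reflection_inverts G_sym core1 dt dr).
exact: tperm_neq1.
Qed.

(** The whole group acts on the plane by rotations. If [r] does not permute the
    bodies cyclically, the involutions [g0] and [g0 * r] fix a common dipole.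
    Otherwise both exchange two bodies antipodally, so that their product [r] acts
    trivially on the plane, and [r ^+ 3] would be redundant if it were not [1]. *)
Lemma rotation_generator_case : ~ type_R G -> \det (rho G r) = 1 ->
  exists L, conjugated (image_group G) (@model_group R L).
Proof.
move=> nR drho.
have rho_gen k : \det (rho G (r ^+ k)%g) = 1.
  by rewrite det_rhoX drho expr1n.
have [g0 [dt0 dg0]] : exists g0, \det (tau G g0) = -1 /\ \det (rho G g0) = 1.
  apply: contrapT => no; apply: nR => g.
  have [d|d] := det_orthogonal (tau_orthogonal G_sym g); rewrite d.
    by have [k ->] := gen d.
  have [d'|//] := det_orthogonal (rho_orthogonal G_sym g).
  by case: no; exists g.
have dt1 : \det (tau G (g0 * r)%g) = -1.
  by rewrite (tau_hom G_sym) det_mulmx dt0 dr mulr1.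
have dg1 : \det (rho G (g0 * r)%g) = 1.
  by rewrite (rho_hom G_sym) det_mulmx dg0 drho mulr1.
have [zN|zN] := pselect (forall i, z i != i); last first.
  have [i [j [ij zij tij]]] := sigma_pair dt0 zN.
  exfalso; apply: (no_fixed_dipole ij circ0_neq0) => g.
  have f0 := reflection_fixes_dipole (circ 0) dt0 dg0 ij tij.
  have f1 : conf_act G (g0 * r)%g (dipole m i j (circ 0)) = dipole m i j (circ 0).
    apply: (reflection_fixes_dipole _ dt1 dg1 ij); rewrite (sigmaM G_sym) -/z.
    case: zij => ->; case: tij => ->; rewrite ?mul1g ?mulg1 ?tperm2;
      by [left|right].
  have fr : conf_act G r (dipole m i j (circ 0)) = dipole m i j (circ 0).
    have -> : r = (g0 * (g0 * r))%g.
      by rewrite mulgA (time_reflection_invol G_sym core1 dt0) mul1g.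
    by rewrite (conf_actM G_sym) f1 f0.
  have [k [->|->]] := generator_reflection G_sym core1 gen dt0 g.
    exact: dipole_fixed_pow.
  by rewrite (conf_actM G_sym) f0 dipole_fixed_pow.
have m0 := inverting_moves dt0 zN; have m1 := inverting_moves dt1 zN.
have [[_ /eqP]|[r0 [i [j [ij tij]]]]] := reflection_cases dt0 dg0.
  by rewrite (negPf m0).
have [[_ /eqP]|[r1 _]] := reflection_cases dt1 dg1.
  by rewrite (negPf m1).
have rr : rho G r = 1%:M.
  by move: r1; rewrite (rho_hom G_sym) r0 mulNmx mul1mx => /oppr_inj.
have n3 : n = 3%N.
  apply: (n_minimal _ (dvd3n zN)) => //; first by rewrite (rhoX G_sym) rr expr1n.
  by rewrite (sigmaX G_sym) -/z z3.
have [a ta] := orthogonal_detN1 (tau_orthogonal G_sym g0) dt0.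
exists D6; apply: (D6_model F1 FM zN ij (generator_reflection G_sym core1 gen dt0)).
  by rewrite /F tr rr n3.
by rewrite /F ta r0 tij.
Qed.

(** If [r] does not permute the bodies cyclically, it fixes a dipole directed along
    the axis of [rho r] or orthogonal to it, according to [sigma r], and the
    reflections [g] with [\det (rho g) = 1] fix every dipole on the same two bodies.
    Otherwise [r ^+ 6] would be redundant if it were not [1]. *)
Lemma reflection_generator_case : \det (rho G r) = -1 ->
  exists L, conjugated (image_group G) (@model_group R L).
Proof.
move=> drho; have [b rb] := orthogonal_detN1 (rho_orthogonal G_sym r) drho.
have no_transp : forall i j, i != j -> z = 1%g \/ z = tperm i j ->
    (forall g, \det (tau G g) = 1) -> False.
  move=> i j ij zij cyc; have [e e0 fr] := axis_exists ij drho zij.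
  by apply: (no_fixed_dipole ij e0) => g; have [k ->] := gen (cyc g); exact: dipole_fixed_pow.
have n6 : (forall i, z i != i) -> n = 6%N.
  move=> zN; apply: n_minimal => //.
  - rewrite (@Gauss_dvd 2 3)// dvd3n// andbT.
    have : (-1) ^+ n = 1 :> R.
      rewrite -drho -det_rhoX -(generator_order G_sym core1 n_gt0 tr).
      by rewrite expg_order (rho1 G_sym) det1.
    rewrite -signr_odd dvdn2; case: (odd n) => //=; rewrite expr1 => e.
    by have h : 0 < 1 :> R := ltr01; exfalso; lra.
  - rewrite (rhoX G_sym) rb (_ : 6%N = 2 * 3)%N// exprM expr2.
    by rewrite [X in X ^+ 3](reflection_invol b) expr1n.
  - by rewrite (sigmaX G_sym) -/z (_ : 6%N = 3 * 2)%N// expgM z3// expg1n.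
have pi6 : 2 * pi / 6%:R = pi / 3 :> R by field.
have [[g dt]|cyc] := pselect (exists g, \det (tau G g) = -1); last first.
  have cyc' g : \det (tau G g) = 1.
    have [//|d] := det_orthogonal (tau_orthogonal G_sym g).
    by case: cyc; exists g.
  have [zN|zN] := pselect (forall i, z i != i).
    exists C6; apply: (C6_model F1 FM zN (fun g => gen (cyc' g))).
    by rewrite /F tr n6// pi6 rb.
  exfalso; have [z1|[i [j [ij zij]]]|//] := perm3P z.
    by apply: (no_transp 0 1) => //; left.
  by apply: (no_transp i j) => //; right.
have [g0 [dt0 dg0]] : exists g0, \det (tau G g0) = -1 /\ \det (rho G g0) = 1.
  have [d|d] := det_orthogonal (rho_orthogonal G_sym g); first by exists g.
  exists (g * r)%g; rewrite (tau_hom G_sym) (rho_hom G_sym) !det_mulmx dt dr d drho.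
  by rewrite mulr1 mulrNN mulr1.
have [zN|zN] := pselect (forall i, z i != i); last first.
  have [i [j [ij zij tij]]] := sigma_pair dt0 zN.
  have [e e0 fr] := axis_exists ij drho zij.
  exfalso; apply: (no_fixed_dipole ij e0) => h.
  have f0 := reflection_fixes_dipole e dt0 dg0 ij tij.
  have [k [->|->]] := generator_reflection G_sym core1 gen dt0 h.
    exact: dipole_fixed_pow.
  by rewrite (conf_actM G_sym) f0 dipole_fixed_pow.
have [[_ /eqP]|[r0 [i [j [ij tij]]]]] := reflection_cases dt0 dg0.
  by rewrite (negPf (inverting_moves dt0 zN)).
have [a ta] := orthogonal_detN1 (tau_orthogonal G_sym g0) dt0.
exists D12; apply: (D12_model F1 FM zN ij (generator_reflection G_sym core1 gen dt0)).
  by rewrite /F tr n6// pi6 rb.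
by rewrite /F ta r0 tij.
Qed.

End NotTypeR.

(** * The classification *)

Theorem theorem1 (R : realType) (m : 'I_3 -> R) (alpha : R)
    (m_gt0 : forall i, 0 < m i) (alpha_gt0 : 0 < alpha)
    (gT : finGroupType) (G : sym_data R gT)
    (G_sym : symmetry_group m G)
    (G_faithful : trivial_kernel G)
    (G_spans : spans_plane m G)
    (G_prime : no_common_covering m G) :
  bound_to_collisions m G \/ fully_uncoercive m alpha G \/ homographic m G \/
  exists L : model, conjugated_up_to_frame G L.
Proof.
have [|not_bound] := pselect (bound_to_collisions m G); first by left.
have [|not_homographic] := pselect (homographic m G); first by right; right; left.
right; have [x [v [xv xG x_free]]] := not_boundP not_bound.
have core_rot g : tau G g = 1%:M -> \det (rho G g) = 1 -> g = 1%g.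
  exact: (core_rotation1 G_sym G_faithful xv xG x_free not_homographic).
have [typeR|not_typeR] := pselect (type_R G).
  right; right; apply: (type_R_model G_sym) => // g tg.
  by apply: core_rot; rewrite // typeR tg det1.
have [coer|not_coer] := pselect (coercive m alpha G); last by left.
right; right.
have no_dipole i j (e : 'cV[R]_2) : i != j -> e != 0 ->
    ~ (forall g, conf_act G g (dipole m i j e) = dipole m i j e).
  move=> ij e0 fixed.
  apply: (fixed_conf_not_coercive m_gt0 alpha_gt0 xv xG x_free _ fixed _ coer).
    exact: dipole_centred.
  by exists i; rewrite /dipole eqxx scaler_eq0 negb_or gt_eqF ?m_gt0.
have core1 g : tau G g = 1%:M -> g = 1%g.
  move=> tg; have [d|d] := det_orthogonal (rho_orthogonal G_sym g).
    exact: core_rot.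
  have [i [j [ij sij]]] := core_reflection G_sym G_faithful xv xG x_free
    not_homographic G_spans tg d.
  have [e e0 fixed] := core_reflection_fixed_dipole G_sym G_faithful xv xG x_free
    not_homographic tg d ij sij.
  by case: (no_dipole i j e).
have [r [n [n_gt0 tr gen]]] := rotation_generator G_sym core1.
suff [L conjL] : exists L, conjugated (image_group G) (@model_group R L).
  by exists L; left.
have [d|d] := det_orthogonal (rho_orthogonal G_sym r).
  exact: (rotation_generator_case G_sym core1 G_prime xG x_free no_dipole n_gt0 tr gen
    not_typeR d).
exact: (reflection_generator_case G_sym core1 G_prime xG x_free no_dipole n_gt0 tr gen d).
Qed.
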